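(* There is an efficient non-adaptive quantum algorithm that solves (with high probability) the hidden many-cut problem with parameter $\epsilon$ on $n$ qubits, which uses $O\left(n/\epsilon^{2}\right)$ copies of the unknown state, runs in polynomial time, and requires only circuits of constant depth acting on two copies at a time, using no additional auxiliary qubits.
   Context: Hidden many-cut problem with parameter $\epsilon>0$: one is given copies of an unknown unit vector $|\psi\rangle\in(\mathbb{C}^2)^{\otimes n}$ that is a product of $m\ge1$ factor state vectors, $|\psi\rangle=|\phi_1\rangle_{C_1}\otimes\cdots\otimes|\phi_m\rangle_{C_m}$, for some unknown partition $C_1\sqcup\cdots\sqcup C_m=[n]$ of the qubits (neither $m$ nor the partition is known), such that each factor $|\phi_k\rangle_{C_k}$ is at least $\epsilon$-far in trace distance from any product state on the $|C_k|$ qubits, where a product state means a state that factorizes as a tensor product across some bipartition of $C_k$ into two non-empty parts (this is vacuous if $|C_k|=1$). The trace distance of pure states is $\sqrt{1-|\langle\phi|\phi'\rangle|^2}$. The task is to identify the set partition $C_1\sqcup\cdots\sqcup C_m$. ''Non-adaptive'' means that the same measurement is performed repeatedly and independently of earlier outcomes, followed by classical post-processing. ''With high probability'' means with success probability at least a fixed constant such as $2/3$. ''Polynomial time'' means polynomial in $n$ and $1/\epsilon$. Circuit depth is counted in one- and two-qubit gates with all-to-all connectivity, followed by computational-basis measurements. The $O(\cdot)$ hides an absolute constant. *)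

(* Defs.v *)
From HB Require Import structures.
From mathcomp Require Import all_boot all_order all_algebra.
From mathcomp Require Import reals.
From mathcomp.real_closed Require Import complex.

Set Implicit Arguments.
Unset Strict Implicit.
Unset Printing Implicit Defensive.

Import Order.TTheory GRing.Theory Num.Theory.
Local Open Scope ring_scope.

Notation bits Q := {ffun Q -> bool}.

(* Amplitudes in the computational basis, which is indexed by [bits Q]. *)
Notation vec R Q := {ffun bits Q -> R[i]}.

Section States.
Variable R : realType.

Definition sqmod (z : R[i]) : R := ComplexField.Normc.normc z ^+ 2.

Definition unit_vec (Q : finType) (v : vec R Q) : Prop :=
  \sum_b sqmod (v b) = 1.

Definition inner (Q : finType) (v w : vec R Q) : R[i] :=
  \sum_b (v b)^* * w b.

Definition trace_dist (Q : finType) (v w : vec R Q) : R :=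
  Num.sqrt (1 - sqmod (inner v w)).

Definition restr (Q : finType) (A : {set Q}) (b : bits Q) :
    bits {x : Q | x \in A} :=
  [ffun x => b (val x)].

Definition is_product_state (Q : finType) (v : vec R Q) : Prop :=
  exists B : {set Q}, [/\ B != set0, ~: B != set0 &
    exists (a : vec R {x : Q | x \in B}) (c : vec R {x : Q | x \in ~: B}),
      [/\ unit_vec a, unit_vec c &
          forall b, v b = a (restr B b) * c (restr (~: B) b)]].

Definition far_from_product (eps : R) (Q : finType) (v : vec R Q) : Prop :=
  forall w : vec R Q, is_product_state w -> eps <= trace_dist v w.

(* [phi A] is only relevant when [A] is a block of [P]. *)
Definition many_cut_instance (n : nat) (eps : R) (P : {set {set 'I_n}})
    (psi : vec R 'I_n) : Prop :=
  [/\ partition P [set: 'I_n], unit_vec psi &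
    exists phi : forall A : {set 'I_n}, vec R {i : 'I_n | i \in A},
      (forall A, A \in P -> unit_vec (phi A) /\ far_from_product eps (phi A)) /\
      (forall b, psi b = \prod_(A in P) phi A (restr A b))].

(* The qubits of the first copy are the [lshift n i], those of the second copy
   the [rshift n i]. *)
Definition two_copies (n : nat) (psi : vec R 'I_n) : vec R 'I_(n + n) :=
  [ffun b : bits 'I_(n + n) =>
     psi [ffun i => b (lshift n i)] * psi [ffun i => b (rshift n i)]].

(* Finitely many gates with algebraic entries, so that a circuit has a finite
   description that a classical program can write down. *)
Record gate_set := GateSet {
  num1 : nat;
  num2 : nat;
  gate1 : 'I_num1 -> 'M[R[i]]_2;
  gate2 : 'I_num2 -> 'M[R[i]]_4;
  gate1_unitary : forall g, gate1 g \is unitarymx;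
  gate2_unitary : forall g, gate2 g \is unitarymx;
  gate1_algebraic : forall g i j,
    algebraicOver (ratr : rat -> R[i]) (gate1 g i j);
  gate2_algebraic : forall g i j,
    algebraicOver (ratr : rat -> R[i]) (gate2 g i j)
}.

Variable G : gate_set.

Inductive gate_app (N : nat) :=
| App1 of 'I_(num1 G) & 'I_N
| App2 of 'I_(num2 G) & 'I_N & 'I_N.

Definition gate_qubits N (a : gate_app N) : seq 'I_N :=
  match a with App1 _ q => [:: q] | App2 _ q r => [:: q; r] end.

(* The gates of a layer are executed in parallel, so the depth of a circuit is
   the [size] of its list of layers. *)
Definition layer N := seq (gate_app N).
Definition circuit N := seq (layer N).

Definition layer_wf N (l : layer N) : bool :=
  uniq (flatten [seq gate_qubits a | a <- l]).
Definition circuit_wf N (c : circuit N) : bool := all (@layer_wf N) c.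
Definition num_gates N (c : circuit N) : nat := size (flatten c).

Definition set_bit N (b : bits 'I_N) (q : 'I_N) (x : bool) : bits 'I_N :=
  [ffun i => if i == q then x else b i].

(* Rows and columns of a gate follow the order |0>, |1>, resp.
   |00>, |01>, |10>, |11>. *)
Definition idx1 (x : bool) : 'I_2 := inord x.
Definition idx2 (x y : bool) : 'I_4 := inord (2 * x + y)%N.

Definition run_gate N (v : vec R 'I_N) (a : gate_app N) : vec R 'I_N :=
  match a with
  | App1 g q =>
      [ffun b : bits 'I_N =>
        \sum_(x : bool) gate1 g (idx1 (b q)) (idx1 x) * v (set_bit b q x)]
  | App2 g q r =>
      [ffun b : bits 'I_N =>
        \sum_(x : bool) \sum_(y : bool)
          gate2 g (idx2 (b q) (b r)) (idx2 x y)
          * v (set_bit (set_bit b q x) r y)]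
  end.

Definition run_circuit N (c : circuit N) (v : vec R 'I_N) : vec R 'I_N :=
  foldl (@run_gate N) v (flatten c).

Definition outcome_prob N (c : circuit N) (v : vec R 'I_N) (o : bits 'I_N) : R :=
  sqmod (run_circuit c v o).

End States.

(* Classical computation is expressed in the WHILE language on binary trees of
   Neil Jones (Computability and Complexity), whose polynomial-time programs
   decide exactly the class P. *)
Inductive tree := TNil | TCons of tree & tree.

Definition hd t := if t is TCons a _ then a else TNil.
Definition tl t := if t is TCons _ a then a else TNil.

Inductive expr :=
| EVar of nat
| ENil
| ECons of expr & expr
| EHd of expr
| ETl of expr.

Inductive com :=
| Skip
| Assign of nat & expr
| Seq of com & com
| If of expr & com & com
| While of expr & com.

Definition store := nat -> tree.

Definition update (s : store) (x : nat) (t : tree) : store :=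
  fun y => if y == x then t else s y.

Fixpoint eval (s : store) (e : expr) : tree :=
  match e with
  | EVar x => s x
  | ENil => TNil
  | ECons e1 e2 => TCons (eval s e1) (eval s e2)
  | EHd e1 => hd (eval s e1)
  | ETl e1 => tl (eval s e1)
  end.

(* Trees are shared, so every constructor of an expression costs one unit. *)
Fixpoint cost (e : expr) : nat :=
  match e with
  | EVar _ | ENil => 1
  | ECons e1 e2 => (cost e1 + cost e2).+1
  | EHd e1 | ETl e1 => (cost e1).+1
  end.

(* [exec c s s' t]: from store [s], [c] terminates in store [s'] after [t]
   steps.  Exactly [TNil] counts as false. *)
Inductive exec : com -> store -> store -> nat -> Prop :=
| ExecSkip s : exec Skip s s 1
| ExecAssign s x e : exec (Assign x e) s (update s x (eval s e)) (cost e).+1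
| ExecSeq c1 c2 s1 s2 s3 t1 t2 :
    exec c1 s1 s2 t1 -> exec c2 s2 s3 t2 ->
    exec (Seq c1 c2) s1 s3 (t1 + t2)
| ExecIfTrue e c1 c2 s s' t :
    eval s e <> TNil -> exec c1 s s' t ->
    exec (If e c1 c2) s s' (cost e + t).+1
| ExecIfFalse e c1 c2 s s' t :
    eval s e = TNil -> exec c2 s s' t ->
    exec (If e c1 c2) s s' (cost e + t).+1
| ExecWhileFalse e c s :
    eval s e = TNil -> exec (While e c) s s (cost e).+1
| ExecWhileTrue e c s1 s2 s3 t1 t2 :
    eval s1 e <> TNil -> exec c s1 s2 t1 -> exec (While e c) s2 s3 t2 ->
    exec (While e c) s1 s3 (cost e + t1 + t2).+1.

(* Input and output are passed in variable 0. *)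
Definition computes_within (p : com) (input output : tree) (t : nat) : Prop :=
  exists (s : store) (t' : nat),
    [/\ exec p (update (fun=> TNil) 0%N input) s t', s 0%N = output & (t' <= t)%N].

Fixpoint enc_nat (k : nat) : tree :=
  if k is k'.+1 then TCons TNil (enc_nat k') else TNil.

Definition enc_seq (T : Type) (f : T -> tree) (s : seq T) : tree :=
  foldr (fun x t => TCons (f x) t) TNil s.

Definition enc_bits N (o : bits 'I_N) : tree :=
  enc_seq enc_nat [seq nat_of_bool (o q) | q <- enum 'I_N].

Definition enc_gate (R : realType) (G : gate_set R) N (a : gate_app G N) : tree :=
  match a with
  | App1 g q => TCons (enc_nat 0) (enc_seq enc_nat [:: (g : nat); (q : nat)])
  | App2 g q r =>
      TCons (enc_nat 1) (enc_seq enc_nat [:: (g : nat); (q : nat); (r : nat)])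
  end.

Definition enc_circuit (R : realType) (G : gate_set R) N (c : circuit G N) : tree :=
  enc_seq (enc_seq (@enc_gate R G N)) c.

(* The real parameter eps is presented to the classical programs through the
   integer ceil (1 / eps), in unary. *)
Definition enc_params (R : realType) (n : nat) (eps : R) : tree :=
  TCons (enc_nat n) (enc_nat `|Num.ceil eps^-1|%N).

(* [generator] maps the parameters to the number of rounds and the circuit that
   is run in every round; [postproc] maps the parameters and the list of all
   measurement outcomes to a labelling of the qubits. *)
Record algorithm (R : realType) := Algorithm {
  gates : gate_set R;
  generator : com;
  postproc : com
}.

(* A labelling of the qubits denotes the partition into its level sets. *)
Definition identifies n (labels : seq nat) (P : {set {set 'I_n}}) : bool :=
  (size labels == n) &&
  (preim_partition (fun i : 'I_n => nth 0%N labels i) [set: 'I_n] == P).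

(* What the algorithm does for given n and eps: it runs [circ] in each of [T]
   independent rounds, each consuming two fresh copies, and answers [answer o]
   on outcomes [o].  The circuit acts on exactly the 2n qubits of the two
   copies.  The total number of steps on any outcomes is at most [time]. *)
Definition executes (R : realType) (alg : algorithm R) (n : nat) (eps : R)
    (T : nat) (circ : circuit (gates alg) (n + n))
    (answer : T.-tuple (bits 'I_(n + n)) -> seq nat) (time : nat) : Prop :=
  exists tgen tpost : nat,
    [/\ computes_within (generator alg) (enc_params n eps)
          (TCons (enc_nat T) (enc_circuit circ)) tgen,
        circuit_wf circ,
        forall o : T.-tuple (bits 'I_(n + n)),
          computes_within (postproc alg)
            (TCons (enc_params n eps) (enc_seq (@enc_bits (n + n)) o))
            (enc_seq enc_nat (answer o)) tpost &
        (tgen + T * (num_gates circ + (n + n)) + tpost <= time)%N].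

Definition success_prob (R : realType) (G : gate_set R) (n T : nat)
    (circ : circuit G (n + n))
    (answer : T.-tuple (bits 'I_(n + n)) -> seq nat)
    (psi : vec R 'I_n) (P : {set {set 'I_n}}) : R :=
  \sum_(o : T.-tuple (bits 'I_(n + n)) | identifies (answer o) P)
    \prod_(t < T) outcome_prob circ (two_copies psi) (tnth o t).

(* Main.v *)
Require Import Defs.
From mathcomp Require Import all_boot all_order all_algebra.
From mathcomp Require Import reals.
From mathcomp.real_closed Require Import complex.
From mathcomp Require Import zify ring lra.

Set Implicit Arguments.
Unset Strict Implicit.
Unset Printing Implicit Defensive.

Import Order.TTheory GRing.Theory Num.Theory.

(* Measure every qubit of the first copy jointly with its partner in the second
   copy in a basis containing the singlet.  For a set X of qubits, the sign
   (-1)^(number of singlets found in X) has expectation <psi psi|SWAP_X|psi psi>,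
   the purity of the reduced state of psi on X.  It is 1 if X is a union of blocks,
   and its modulus is at most sqrt (1 - eps^2) if X cuts a block.  By a union bound
   over the 2^n sets X, after O(n / eps^2) rounds the sets meeting every sample in an
   even number of singlets are exactly the unions of blocks, with probability at
   least 2/3.

   The blocks are read off by incremental elimination over F_2: every qubit i
   carries a vector c_i, initially the unit vector e_i, and each sample is
   quotiented out by adding a multiple of sum_(i in sample) c_i to all c_i so as to
   clear its pivot coordinate.  At the end c_i is the unit vector of a
   representative of the block of i. *)

(** * Programs *)

(** For a cut set the purity is a sum over basis labels of overlaps of psi with multiples of product
    states across the cut; Cauchy-Schwarz carries the distance hypothesis over to the sum. An even
    parity then has probability at most (1 + sqrt (1 - eps^2)) / 2 <= 1 - eps^2 / 4, and with k =
    ceil (1 / eps), 12 k^2 n rounds bring this down to 8^-n, which survives a union bound over 2^n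
    sets. Unions of blocks need no estimate: a sign of expectation 1 is almost surely 1. The sets
    with even parity on all samples form the annihilator of the span of the samples, that is, the
    dual of the quotient of F_2^n by that span. Hence two qubits share a block iff their unit
    vectors agree in the quotient. The elimination keeps an explicit model of the quotient map after
    every sample, so neither ranks nor row orders are tracked. Running time is demanded on every
    list of outcomes, so the programs are verified for arbitrary samples and probability enters only
    afterwards. *)

Section Programs.

(* Stores with finite support are given as lists; equality is pointwise so that no
   functional extensionality is needed. *)
Definition runs (c : com) (l l' : seq tree) (t : nat) : Prop :=
  forall s, s =1 nth TNil l ->
  exists s' t', [/\ exec c s s' t', s' =1 nth TNil l' & t' <= t].

Lemma eq_eval s s' e : s =1 s' -> eval s e = eval s' e.
Proof.
move=> eqs; elim: e => //= [e1 -> e2 ->|e ->|e ->] //.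
Qed.

Lemma runs_le c l l' t t' : runs c l l' t -> t <= t' -> runs c l l' t'.
Proof.
move=> h le s /h [s' [u [h1 h2 h3]]]; exists s', u; split=> //.
exact: leq_trans le.
Qed.

Lemma eq_runs c l1 l2 l3 l4 t :
  nth TNil l1 =1 nth TNil l2 -> nth TNil l3 =1 nth TNil l4 ->
  runs c l1 l3 t -> runs c l2 l4 t.
Proof.
move=> e1 e2 h s es.
have [s' [u [h1 h2 h3]]] := h s (ftrans es (fsym e1)).
by exists s', u; split=> // y; rewrite h2 e2.
Qed.

Lemma runs_skip l : runs Skip l l 1.
Proof. by move=> s es; exists s, 1; split=> //; exact: ExecSkip. Qed.

Lemma runs_assign x e l :
  runs (Assign x e) l (set_nth TNil l x (eval (nth TNil l) e)) (cost e).+1.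
Proof.
move=> s es; exists (update s x (eval s e)), (cost e).+1; split=> //.
  exact: ExecAssign.
by move=> y; rewrite nth_set_nth /= /update es (eq_eval _ es).
Qed.

Lemma runs_seq c1 c2 l1 l2 l3 t1 t2 :
  runs c1 l1 l2 t1 -> runs c2 l2 l3 t2 -> runs (Seq c1 c2) l1 l3 (t1 + t2).
Proof.
move=> h1 h2 s /h1 [s' [u [e1 es le1]]].
have [s'' [v [e2 es' le2]]] := h2 _ es.
exists s'', (u + v); split=> //; first exact: ExecSeq e2.
exact: leq_add.
Qed.

Definition enc_bool (b : bool) : tree := enc_nat b.

Lemma runs_if (b : bool) e c1 c2 l l' t :
  eval (nth TNil l) e = enc_bool b -> runs (if b then c1 else c2) l l' t ->
  runs (If e c1 c2) l l' (cost e + t).+1.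
Proof.
move=> ee h s es; have [s' [u [h1 h2 h3]]] := h s es.
have {}ee : eval s e = enc_bool b by rewrite (eq_eval _ es).
exists s', (cost e + u).+1; split; rewrite ?ltnS ?leq_add2l //.
by case: b {h} h1 ee => h1 ee; [apply: ExecIfTrue | apply: ExecIfFalse];
  rewrite ?ee.
Qed.

Lemma runs_while_nil e c l :
  eval (nth TNil l) e = TNil -> runs (While e c) l l (cost e).+1.
Proof.
move=> ee s es; exists s, (cost e).+1; split=> //.
by apply: ExecWhileFalse; rewrite (eq_eval _ es).
Qed.

Lemma runs_while_cons e c l1 l2 l3 t1 t2 :
  eval (nth TNil l1) e <> TNil -> runs c l1 l2 t1 -> runs (While e c) l2 l3 t2 ->
  runs (While e c) l1 l3 (cost e + t1 + t2).+1.
Proof.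
move=> ee h1 h2 s es; have [s' [u [e1 es' le1]]] := h1 _ es.
have [s'' [v [e2 es'' le2]]] := h2 _ es'.
exists s'', (cost e + u + v).+1; split=> //.
  by apply: ExecWhileTrue e1 e2; rewrite (eq_eval _ es).
by rewrite ltnS leq_add // leq_add2l.
Qed.

Lemma runs_computes c l t x y :
  runs c [:: x] l t -> nth TNil l 0 = y -> computes_within c x y t.
Proof.
move=> h <-.
have [|s [u [h1 h2 h3]]] := h (update (fun=> TNil) 0 x).
  by case=> // i; rewrite /update /= nth_nil.
by exists s, u.
Qed.

Local Coercion EVar : nat >-> expr.
Local Notation "x ::= e" := (Assign x e) (at level 60, right associativity).
Local Notation "c1 ;; c2" := (Seq c1 c2) (at level 70, right associativity).

Definition for_each (x : nat) (body : com) : com :=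
  While x (body ;; x ::= ETl x).


(* [L v b] is the store in which the loop variable [x] holds [v] and the other
   variables are determined by the accumulator [b]. *)
Lemma runs_for_each (A B : Type) (f : A -> tree) (L : tree -> B -> seq tree)
    (F : B -> A -> B) (I : B -> Prop) (x : nat) (body : com) (t : nat) (u : seq A)
    (b : B) :
  (forall v b, nth TNil (L v b) x = v) ->
  (forall v v' b, set_nth TNil (L v b) x v' = L v' b) ->
  (forall a u1 u2 b, u = u1 ++ a :: u2 -> I b ->
    runs body (L (enc_seq f (a :: u2)) b) (L (enc_seq f (a :: u2)) (F b a)) t /\
    I (F b a)) ->
  I b ->
  runs (for_each x body) (L (enc_seq f u) b) (L TNil (foldl F b u))
    ((t + 5) * (size u).+1).
Proof.
move=> Lx setL; rewrite /for_each; elim: u b => [|a u IH] b step Ib.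
  by apply: runs_le (runs_while_nil _ _) _; rewrite /= ?Lx //; lia.
have [h1 h2] := step a [::] u b erefl Ib.
apply: runs_le.
  eapply runs_while_cons.
  - by rewrite /= Lx.
  - by apply: runs_seq h1 _; exact: runs_assign.
  rewrite /= Lx setL; apply: IH (h2).
  by move=> a' u1 u2 b' eu; apply: (step a' (a :: u1)); rewrite eu.
by rewrite /=; lia.
Qed.

(** Loops build lists by consing, hence in reverse; pouring such a list into another variable
    restores its order. *)
Definition pour (x y : nat) : com := for_each x (y ::= ECons (EHd x) y).

Lemma runs_pour (A : Type) (f : A -> tree) (x y : nat) l u v :
  x != y -> nth TNil l x = enc_seq f u -> nth TNil l y = enc_seq f v ->
  runs (pour x y) l
    (set_nth TNil (set_nth TNil l y (enc_seq f (catrev u v))) x TNil)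
    (20 * (size u).+1).
Proof.
move=> neq; have neq' : (y == x) = false by rewrite eq_sym (negbTE neq).
rewrite /pour /for_each; elim: u v l => [|a u IH] v l lx ly /=.
  apply: eq_runs (runs_le (runs_while_nil _ _) _); rewrite /= ?lx //.
  move=> i; rewrite !nth_set_nth /= nth_set_nth /=.
  by case: eqP => [->|_]; rewrite ?lx //; case: eqP => [->|].
apply: runs_le.
  eapply runs_while_cons.
  - by rewrite /= lx.
  - by apply: runs_seq; apply: runs_assign.
  apply: eq_runs (IH (a :: v) _ _ _) => //.
  - move=> i; rewrite !nth_set_nth /= !nth_set_nth /= !nth_set_nth /=.
    by case: eqP => // _; rewrite nth_set_nth /=; case: eqP.
  - rewrite nth_set_nth /= eqxx. rewrite nth_set_nth /= (negbTE neq) lx //.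
  - rewrite nth_set_nth /= neq'. rewrite nth_set_nth /= eqxx lx ly //.
by rewrite /=; lia.
Qed.

(** Variables 0 and 1 hold the summands and 2 collects the sum in reverse. Past the end of variable
    1 its head is [TNil], which encodes [false]; a surplus of variable 1 is carried over by
    [pour 1 2]. *)
Definition xor_com : com :=
  for_each 0 (If (EHd 0) (If (EHd 1) (2 ::= ECons ENil 2)
                                     (2 ::= ECons (ECons ENil ENil) 2))
                         (2 ::= ECons (EHd 1) 2) ;;
              1 ::= ETl 1) ;;
  pour 1 2 ;; pour 2 0.

(* Vectors over F_2 of different lengths are padded with zeros. *)
Fixpoint xorl (u v : seq bool) : seq bool :=
  match u, v with
  | [::], _ => v
  | _, [::] => u
  | a :: u', b :: v' => (a (+) b) :: xorl u' v'
  end.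

Notation enc_bools := (enc_seq enc_bool).
Notation enc_cols := (enc_seq enc_bools).

Lemma nth_xorl u v q : nth false (xorl u v) q = nth false u q (+) nth false v q.
Proof.
elim: u v q => [|a u IH] [|b v] [|q] //=; rewrite ?addbF ?nth_nil //.
Qed.

Lemma size_xorl u v : size (xorl u v) = maxn (size u) (size v).
Proof. by elim: u v => [|a u IH] [|b v] //=; rewrite ?max0n // IH maxnSS. Qed.

Lemma runs_xor u v l :
  runs xor_com [:: enc_bools u, enc_bools v, TNil & l]
    [:: enc_bools (xorl u v), TNil, TNil & l]
    (100 * (size u + size v).+1).
Proof.
pose L x (p : seq bool * seq bool) := [:: x, enc_bools p.1, enc_bools p.2 & l].
pose F := fun (p : seq bool * seq bool) a =>
  (behead p.1, (a (+) head false p.1) :: p.2).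
have foldF w v' : foldl F (v', w) u =
    (drop (size u) v', catrev (xorl u (take (size u) v')) w).
  elim: u v' w {v} => [|a u IH] [|b v'] w //=; rewrite ?drop0 ?take0 //=.
    by rewrite IH /= addbF; case: (u).
  by rewrite IH.
apply: runs_le; first apply: (@runs_seq _ _ _ (L TNil (foldl F (v, [::]) u))).
- apply: (@runs_for_each _ _ enc_bool L F (fun=> True) 0 _ 20 u (v, [::])) => //.
  move=> a u1 u2 [p1 p2] _ _; split=> //.
  have e2 a' : runs (1 ::= ETl 1) (L a' (p1, (a (+) head false p1) :: p2))
       (L a' (F (p1, p2) a)) 3.
    by case: p1 => [|b p1]; exact: runs_assign.
  apply: (@runs_le _ _ _ (17 + 3)) => //; apply: runs_seq (e2 _).
  apply: (@runs_le _ _ _ (2 + 14).+1) => //; apply: (@runs_if a) => //.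
  case: a {e2}.
    apply: (@runs_le _ _ _ (2 + 11).+1) => //; apply: (@runs_if (head false p1)).
      by case: (p1).
    by case: (head _ _); (apply: runs_le; first exact: runs_assign).
  apply: (@runs_le _ _ _ 5) => //.
  by case: (p1) => [|b p1']; exact: runs_assign.
- rewrite foldF; eapply runs_seq.
    exact: (@runs_pour _ enc_bool 1 2 _ (drop (size u) v)
      (catrev (xorl u (take (size u) v)) [::])).
  set w := catrev (drop _ v) _; have <- : catrev w [::] = xorl u v.
    rewrite {}/w.
    rewrite !catrevE !cats0 rev_cat revK revK.
    by elim: u v {L F foldF} => [|a u IH] [|b v] //=; rewrite ?drop0 ?take0 ?cats0 ?IH.
  exact: (@runs_pour _ enc_bool 2 0 _ w [::]).
- rewrite !catrevE !cats0 size_cat !size_rev size_xorl size_drop size_take.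
  case: ltnP; lia.
Qed.

(** * Elimination over F_2 and its program *)

Definition syndrome_step (p : seq bool * seq bool * seq bool) (c : seq bool) :=
  let: (d, a, b) := p in
  ((if head false a && ~~ head false b then xorl d c else d), behead a, behead b).

(** The image of the sample under the current linear map: the sum of the columns of the qubits
    showing a singlet. The outcomes of the second copy start at position [size C] of [a], whence the
    second reading list. *)
Definition syndrome (C : seq (seq bool)) (a : seq bool) : seq bool :=
  (foldl syndrome_step ([::], a, drop (size C) a) C).1.1.

(* The test [true \in d] matters: without it, [index true d] is [size d] for d = 0,
   which may still be a valid position of [c]. *)
Definition pivot_bit (d c : seq bool) : bool :=
  (true \in d) && nth false c (index true d).

Definition eliminate (d c : seq bool) : seq bool :=
  if pivot_bit d c then xorl c d else c.

Definition reduce (C : seq (seq bool)) (a : seq bool) : seq (seq bool) :=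
  map (eliminate (syndrome C a)) C.

Definition unit_column (i : nat) : seq bool := rcons (nseq i false) true.

Definition unit_columns (n : nat) : seq (seq bool) :=
  [seq unit_column i | i <- iota 0 n].

Definition labels (n : nat) (samples : seq (seq bool)) : seq nat :=
  map (index true) (foldl reduce (unit_columns n) samples).

(** While a sample is processed, variables 0, 1, 2 are scratch for [xor_com], 3 holds the columns, 4
    the new columns in reverse, 5 and 6 the two reading lists (in [eliminate_com] the current column
    and its pivot bit), 7 the syndrome, 8 the remaining samples and 9 the copy of the columns that a
    loop consumes. *)
Definition syndrome_com : com :=
  for_each 9 (If (EHd 5)
      (If (EHd 6) Skip (0 ::= 7 ;; 1 ::= EHd 9 ;; xor_com ;; 7 ::= 0 ;; 0 ::= ENil))
      Skip ;;
    5 ::= ETl 5 ;; 6 ::= ETl 6).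

(** Walks down the syndrome in variable 1 and the column in 5 together, until the first one of the
    syndrome. If there is none, variable 6 keeps its initial [TNil], in accordance with the test
    [true \in d] of [pivot_bit]. *)
Definition pivot_com : com :=
  While 1 (If (EHd 1) (6 ::= EHd 5 ;; 1 ::= ENil) (1 ::= ETl 1 ;; 5 ::= ETl 5)).

Definition eliminate_com : com :=
  for_each 9 (5 ::= EHd 9 ;; 0 ::= 5 ;; 1 ::= 7 ;; pivot_com ;; 5 ::= ENil ;;
    If 6 (1 ::= 7 ;; xor_com) Skip ;; 6 ::= ENil ;;
    4 ::= ECons 0 4 ;; 0 ::= ENil).

Definition reduce_com : com :=
  5 ::= EHd 8 ;; 6 ::= EHd 8 ;; 9 ::= 3 ;; for_each 9 (6 ::= ETl 6) ;;
  9 ::= 3 ;; syndrome_com ;;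
  5 ::= ENil ;; 6 ::= ENil ;; 9 ::= 3 ;; 3 ::= ENil ;; eliminate_com ;;
  pour 4 3 ;; 7 ::= ENil.

Definition label_com : com :=
  for_each 4 (1 ::= EHd 4 ;;
    While 1 (If (EHd 1) (1 ::= ENil) (2 ::= ECons ENil 2 ;; 1 ::= ETl 1)) ;;
    0 ::= ECons 2 0 ;; 2 ::= ENil).

Definition postproc_com : com :=
  8 ::= ETl 0 ;; 9 ::= EHd (EHd 0) ;; 0 ::= ENil ;;
  5 ::= ECons (ECons ENil ENil) ENil ;;
  for_each 9 (4 ::= ECons 5 4 ;; 5 ::= ECons ENil 5) ;; 5 ::= ENil ;;
  pour 4 3 ;; for_each 8 reduce_com ;; pour 3 4 ;; label_com.

Ltac run_assign := eapply runs_seq; [exact: runs_assign | rewrite /=].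

Lemma runs_syndrome n C a b d s :
  all (fun c => size c <= n) C -> size d <= n ->
  let: (d', a', b') := foldl syndrome_step (d, a, b) C in
  runs syndrome_com
    [:: TNil; TNil; TNil; enc_cols C; TNil; enc_bools a; enc_bools b;
        enc_bools d; s; enc_cols C]
    [:: TNil; TNil; TNil; enc_cols C; TNil; enc_bools a'; enc_bools b';
        enc_bools d'; s; TNil] ((200 * n.+1 + 60) * (size C).+1) /\ size d' <= n.
Proof.
move=> /allP sC sd.
pose L x (p : seq bool * seq bool * seq bool) := let: (d, a, b) := p in
  [:: TNil; TNil; TNil; enc_cols C; TNil; enc_bools a; enc_bools b;
        enc_bools d; s; x].
have stepI c p : size c <= n -> size p.1.1 <= n -> size (syndrome_step p c).1.1 <= n.
  by move=> sc; case: p => [[u v] w] /=; case: ifP => // _; rewrite size_xorl; lia.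
have := @runs_for_each _ _ enc_bools L syndrome_step (fun p => size p.1.1 <= n)
  9 (If (EHd 5)
      (If (EHd 6) Skip (0 ::= 7 ;; 1 ::= EHd 9 ;; xor_com ;; 7 ::= 0 ;; 0 ::= ENil))
      Skip ;;
    5 ::= ETl 5 ;; 6 ::= ETl 6) (200 * n.+1 + 50) C (d, a, b).
case E: foldl => [[d' a'] b'] h.
split; last first.
  have -> : d' = (foldl syndrome_step (d, a, b) C).1.1 by rewrite E.
  elim: C (d, a, b) (sd : size (d, a, b).1.1 <= n) sC {E h L} => //= c C IH p sp sC.
  apply: IH => [|x xC]; last by apply: sC; rewrite inE xC orbT.
  by apply: stepI => //; apply: sC; rewrite inE eqxx.
apply: runs_le; first apply: h => //.
- by move=> v [[]].
- by move=> v v' [[]].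
- move=> c C1 C2 p eC Ip.
  have sc : size c <= n by apply: sC; rewrite eC mem_cat inE eqxx orbT.
  split; last exact: stepI.
  case: p Ip => [[u v] w] /= su; set S := TCons _ _.
  set d1 := if _ then _ else _.
  apply: runs_le; first apply: (@runs_seq _ _ _ (L S (d1, v, w))).
  + apply: (@runs_if (head false v)); first by case: (v).
    instantiate (1 := (2 + (2 * (100 * n.+1) + 20)).+1).
    rewrite /d1; case: (head false v) => /=; last first.
      by apply: runs_le; first exact: runs_skip.
    apply: (@runs_if (head false w)); first by case: (w).
    case: (head false w) => /=.
      by apply: runs_le; first exact: runs_skip.
    apply: runs_le.
      do 2 run_assign.
      eapply runs_seq; first eapply runs_xor.
      run_assign; exact: runs_assign.
    by rewrite /=; lia.
  + by run_assign; case: (v) => [|? ?]; case: (w) => [|? ?]; exact: runs_assign.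
  + rewrite /=; lia.
by rewrite leq_mul2r; apply/orP; right; lia.
Qed.

Lemma runs_pivot d c v0 v2 v3 v4 l :
  runs pivot_com [:: v0, enc_bools d, v2, v3, v4, enc_bools c, TNil & l]
    [:: v0, TNil, v2, v3, v4, enc_bools (drop (index true d) c),
        enc_bool (pivot_bit d c) & l]
    (20 * (size d).+1).
Proof.
rewrite /pivot_bit /pivot_com; elim: d c => [|b d IH] c.
  rewrite drop0 in_nil; apply: runs_le; first exact: runs_while_nil.
  by rewrite /=; lia.
pose l' := if b then
    [:: v0, TNil, v2, v3, v4, enc_bools c, enc_bool (head false c) & l]
  else [:: v0, enc_bools d, v2, v3, v4, enc_bools (behead c), TNil & l].
apply: runs_le.
  apply: (@runs_while_cons _ _ _ l' _ _ (20 * (size d).+1)); first by [].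
  - apply: (@runs_le _ _ _ (2 + 6).+1); last exact: leqnn.
    apply: (@runs_if b); first by [].
    rewrite /l' {IH l'}; case: b; (apply: runs_le; first run_assign).
    + by case: c => [|? ?]; exact: runs_assign.
    + by [].
    + by case: c => [|? ?]; exact: runs_assign.
    + by [].
- rewrite /l' {l'}.
  rewrite inE; case: b => /=.
    by rewrite drop0 nth0; apply: runs_le; [exact: runs_while_nil | rewrite /=; lia].
  case: c => [|a c] /=; last exact: IH.
  by have := IH [::]; rewrite !nth_nil.
rewrite /=; lia.
Qed.

Lemma runs_eliminate n C d s :
  all (fun c => size c <= n) C -> size d <= n ->
  runs eliminate_com
    [:: TNil; TNil; TNil; TNil; TNil; TNil; TNil; enc_bools d; s; enc_cols C]
    [:: TNil; TNil; TNil; TNil; enc_cols (rev (map (eliminate d) C)); TNil; TNil;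
        enc_bools d; s; TNil] ((250 * n.+1 + 60) * (size C).+1).
Proof.
move=> /allP sC sd.
pose L x C' :=
  [:: TNil; TNil; TNil; TNil; enc_cols C'; TNil; TNil; enc_bools d; s; x].
have -> : rev (map (eliminate d) C) = foldl (fun C' c => eliminate d c :: C') [::] C.
  by rewrite -{2}[C]revK foldl_rev -map_rev; elim: (rev C) => //= c C' ->.
apply: runs_le; first apply: (@runs_for_each _ _ enc_bools L _ (fun=> True) _ _
  (220 * n.+1 + 50) C [::]) => //.
  move=> c C1 C2 C' eC _; split=> //.
  have sc : size c <= n by apply: sC; rewrite eC mem_cat inE eqxx orbT.
  set S := enc_seq _ (c :: _).
  apply: runs_le.
    do 3 run_assign.
    eapply runs_seq; first eapply runs_pivot.
    run_assign.
    eapply runs_seq.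
      apply: (@runs_if (pivot_bit d c) _ _ _ _
        [:: enc_bools (eliminate d c); TNil; TNil; TNil; enc_cols C'; TNil;
            enc_bool (pivot_bit d c); enc_bools d; s; S] (200 * n.+1 + 3)) => //.
      rewrite /eliminate. case: pivot_bit.
        apply: runs_le; first by run_assign; eapply runs_xor.
        rewrite /=; lia.
      by apply: runs_le; first exact: runs_skip.
    do 2 run_assign; exact: runs_assign.
  rewrite /=; lia.
rewrite leq_mul2r; apply/orP; right; lia.
Qed.

Lemma runs_reduce n C a s :
  all (fun c => size c <= n) C -> size C = n ->
  let L C x := [:: TNil; TNil; TNil; enc_cols C; TNil; TNil; TNil; TNil; x; TNil] in
  runs reduce_com (L C (TCons (enc_bools a) s)) (L (reduce C a) (TCons (enc_bools a) s))
    (1000 * n.+1 ^ 2) /\ all (fun c => size c <= n) (reduce C a).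
Proof.
move=> allC szC L.
have := @runs_syndrome n C a (drop (size C) a) [::] (TCons (enc_bools a) s) allC isT.
rewrite /reduce /syndrome; case: foldl => [[d a'] b'] [run1 sd].
have run2 := @runs_eliminate n C d (TCons (enc_bools a) s) allC sd.
have run0 : runs (for_each 9 (6 ::= ETl 6))
   [:: TNil; TNil; TNil; enc_cols C; TNil; enc_bools a; enc_bools a; TNil;
       TCons (enc_bools a) s; enc_cols C]
   [:: TNil; TNil; TNil; enc_cols C; TNil; enc_bools a;
       enc_bools (drop (size C) a); TNil; TCons (enc_bools a) s; TNil] (10 * n.+1).
  have -> : drop (size C) a = foldl (fun b _ => behead b) a C.
    elim: C a {L allC szC run1 run2} => [|c C IH] [|b a] //=; rewrite ?drop0 //.
    by have := IH [::].
  pose L' x b := [:: TNil; TNil; TNil; enc_cols C; TNil; enc_bools a; enc_bools b;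
                     TNil; TCons (enc_bools a) s; x].
  apply: runs_le.
    apply: (@runs_for_each _ _ enc_bools L' _ (fun=> True) _ _ 5 C a) => //.
    move=> c C1 C2 b _ _; split=> //; apply: (@runs_le _ _ _ 3) => //.
    by case: b => [|? ?]; exact: runs_assign.
  by rewrite szC.
split; last first.
  apply/allP => _ /mapP[c /(allP allC) sc ->]; rewrite /eliminate.
  by case: ifP => //= _; rewrite size_xorl geq_max sc.
apply: runs_le.
  do 3 run_assign.
  eapply runs_seq; first exact: run0.
  run_assign.
  eapply runs_seq; first exact: run1.
  do 4 run_assign.
  eapply runs_seq; first exact: run2.
  eapply runs_seq.
    exact: (@runs_pour _ enc_bools 4 3 _ (rev (map (eliminate d) C)) [::]).
  rewrite catrevE revK cats0 /=.
  exact: runs_assign.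
rewrite size_rev size_map szC /=; nia.
Qed.

Lemma runs_labels n C d9 :
  all (fun c => size c <= n) C ->
  runs label_com
    [:: TNil; TNil; TNil; TNil; enc_cols (rev C); TNil; TNil; TNil; TNil; d9]
    [:: enc_seq enc_nat (map (index true) C); TNil; TNil; TNil; TNil; TNil; TNil;
        TNil; TNil; d9] ((30 * n.+1) * (size C).+1).
Proof.
move=> /allP sC.
pose L x (l : seq nat) :=
  [:: enc_seq enc_nat l; TNil; TNil; TNil; x; TNil; TNil; TNil; TNil; d9].
have run_index c l S k :
   runs (While 1 (If (EHd 1) (1 ::= ENil) (2 ::= ECons ENil 2 ;; 1 ::= ETl 1)))
   [:: enc_seq enc_nat l; enc_bools c; enc_nat k; TNil; S; TNil; TNil; TNil; TNil; d9]
   [:: enc_seq enc_nat l; TNil; enc_nat (k + index true c); TNil; S; TNil; TNil;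
       TNil; TNil; d9]
   (15 * (size c).+1).
  elim: c k => [|b c IH] k.
    by rewrite addn0; apply: runs_le; [exact: runs_while_nil | rewrite /=; lia].
  pose l' := if b then
     [:: enc_seq enc_nat l; TNil; enc_nat k; TNil; S; TNil; TNil; TNil; TNil; d9]
     else [:: enc_seq enc_nat l; enc_bools c; enc_nat k.+1; TNil; S; TNil; TNil;
              TNil; TNil; d9].
  apply: runs_le.
    apply: (@runs_while_cons _ _ _ l' _ _ (15 * (size c).+1)); first by [].
    - apply: (@runs_le _ _ _ (2 + 8).+1); last exact: leqnn.
      apply: (@runs_if b); first by [].
      rewrite /l' {IH l'}; case: b; (apply: runs_le; first by
        [exact: runs_assign | run_assign; exact: runs_assign]).
        by [].
      by [].
  - rewrite /l' {l'}.
    case: b => /=.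
      by rewrite addn0; apply: runs_le; [exact: runs_while_nil | rewrite /=; lia].
    by rewrite addnS -addSn; exact: (IH k.+1).
  rewrite /=; lia.
have -> : map (index true) C = foldl (fun l c => index true c :: l) [::] (rev C).
  by rewrite foldl_rev; elim: C {sC} => //= c C ->.
rewrite -(size_rev C).
apply: runs_le; first apply: (@runs_for_each _ _ enc_bools L _ (fun=> True) _ _
  (25 * n.+1) (rev C) [::]) => //.
  move=> c C1 C2 l eC _; split=> //.
  have {eC} sc : size c <= n by apply: sC; rewrite -mem_rev eC mem_cat inE eqxx orbT.
  set S := enc_seq _ (c :: _).
  apply: runs_le.
    run_assign.
    eapply runs_seq; first exact: (run_index c l S 0).
    run_assign; exact: runs_assign.
  rewrite /=; lia.
rewrite leq_mul2r; apply/orP; right; lia.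
Qed.

Lemma runs_postproc n (k : tree) samples :
  runs postproc_com
    [:: TCons (TCons (enc_nat n) k) (enc_cols samples)]
    [:: enc_seq enc_nat (labels n samples)]
    (3000 * n.+1 ^ 2 * (size samples).+1).
Proof.
have iota_nat m : enc_nat m = enc_seq (fun=> TNil) (iota 0 m).
  by elim: m 0 => //= m IH k'; rewrite -IH.
set U := enc_cols samples.
pose L x (p : seq (seq bool) * nat) :=
  [:: TNil; TNil; TNil; TNil; enc_cols p.1; enc_bools (unit_column p.2); TNil;
      TNil; U; x].
pose F := fun (p : seq (seq bool) * nat) (_ : nat) => (unit_column p.2 :: p.1, p.2.+1).
have run1 := @runs_for_each _ _ (fun=> TNil) L F
 (fun=> True) 9 (4 ::= ECons 5 4 ;; 5 ::= ECons ENil 5) 10 (iota 0 n) ([::], 0).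
have foldF : foldl F ([::], 0) (iota 0 n) = (rev (unit_columns n), n).
  elim: n {run1} => // n IH; rewrite -addn1 iotaD foldl_cat IH /=.
  by rewrite /F /= /unit_columns iotaD map_cat rev_cat addn1.
have sizeU : size (unit_columns n) = n by rewrite size_map size_iota.
have allU : all (fun c => size c <= n) (unit_columns n).
  by apply/allP => _ /mapP[i + ->]; rewrite mem_iota size_rcons size_nseq.
pose L2 x C := [:: TNil; TNil; TNil; enc_cols C; TNil; TNil; TNil; TNil; x; TNil].
pose I (C : seq (seq bool)) := all (fun c => size c <= n) C && (size C == n).
have run2 := @runs_for_each _ _ enc_bools L2 reduce I 8 reduce_com
  (1000 * n.+1 ^ 2) samples (unit_columns n).
have I0 : I (unit_columns n) by rewrite /I allU sizeU eqxx.
have stepI a C : I C -> I (reduce C a).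
  case/andP => allC /eqP sizeC; rewrite /I size_map sizeC eqxx andbT.
  by case: (runs_reduce a TNil allC sizeC).
set C := foldl reduce (unit_columns n) samples.
have /andP[allC /eqP sizeC] : I C.
  rewrite /C; elim: samples (unit_columns n) I0 {U L run1 run2 C} => //= a s IH C IC.
  by apply: IH; apply: stepI.
(* Padding leaves the store the same pointwise and lets [set_nth] compute on an explicit list of ten
   variables. *)
pose pad := [:: TNil; TNil; TNil; TNil; TNil; TNil; TNil; TNil; TNil].
apply: (@eq_runs _ (TCons (TCons (enc_nat n) k) (enc_cols samples) :: pad) _
  (enc_seq enc_nat (labels n samples) :: pad)).
- by case=> //; do 9 case => //; move=> i; rewrite /= !nth_nil.
- by case=> //; do 9 case => //; move=> i; rewrite /= !nth_nil.
apply: runs_le.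
  do 4 run_assign.
  rewrite iota_nat.
  eapply runs_seq; first (apply: run1 => // m u1 u2 p _ _; split=> //;
    by apply: runs_le; first by run_assign; exact: runs_assign).
  rewrite foldF.
  run_assign.
  eapply runs_seq.
    exact: (@runs_pour _ enc_bools 4 3 _ (rev (unit_columns n)) [::]).
  rewrite catrevE revK cats0 /=.
  eapply runs_seq.
    apply: run2 => // a u1 u2 C' _ IC'; split; last exact: stepI.
    case/andP: IC' => allC' /eqP sizeC'.
    by case: (runs_reduce a (enc_cols u2) allC' sizeC').
  eapply runs_seq.
    exact: (@runs_pour _ enc_bools 3 4 _ C [::]).
  rewrite catrevE cats0 /=.
  exact: runs_labels allC.
rewrite size_iota size_rev sizeU sizeC /=; nia.
Qed.

(* The factor [k.-1] makes the number of rounds 0 for eps >= 1, where O(n / eps^2)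
   leaves room for no copies at all, and every block is a singleton. *)
Definition num_rounds (n k : nat) : nat := k.-1 * (k * (n * 24)).

Definition rounds_com : com :=
  for_each 1 (6 ::= ETl 0 ;;
    for_each 6 (7 ::= EHd 0 ;; for_each 7 (4 ::= iter 24 (ECons ENil) 4))).

(** Consing writes the gates from last to first, so variables 5 and 2 count down from n and 2n for
    the pairs (i, n + i) to come out in increasing order. [ETl (ETl 0)] is k - 1 in unary. *)
Definition generator_com : com :=
  1 ::= EHd 0 ;; 2 ::= EHd 0 ;; for_each 1 (2 ::= ECons ENil 2) ;;
  1 ::= EHd 0 ;; 5 ::= EHd 0 ;;
  for_each 1 (5 ::= ETl 5 ;; 2 ::= ETl 2 ;;
    3 ::= ECons (ECons (ECons ENil ENil) (ECons ENil (ECons 5 (ECons 2 ENil)))) 3) ;;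
  1 ::= ETl (ETl 0) ;; rounds_com ;; 0 ::= ECons 4 (ECons 3 ENil).

Definition enc_pair_gate (p : nat * nat) : tree :=
  TCons (enc_nat 1) (enc_seq enc_nat [:: 0; p.1; p.2]).

Lemma runs_repeat (B : Type) (L : tree -> B -> seq tree) (F : B -> B) (x : nat)
    (body : com) (t k : nat) (b : B) :
  (forall v b, nth TNil (L v b) x = v) ->
  (forall v v' b, set_nth TNil (L v b) x v' = L v' b) ->
  (forall k b, runs body (L (enc_nat k.+1) b) (L (enc_nat k.+1) (F b)) t) ->
  runs (for_each x body) (L (enc_nat k) b) (L TNil (iter k F b))
    ((t + 5) * k.+1).
Proof.
move=> Lx setL step.
have enc_natE m j : enc_nat m = enc_seq (fun=> TNil) (iota j m).
  by elim: m j => //= m IH j; rewrite (IH j.+1).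
have -> : iter k F b = foldl (fun b _ => F b) b (iota 0 k).
  by elim: k b 0 => // k IH b j; rewrite iterSr (IH _ j.+1).
rewrite (enc_natE k 0) -{3}(size_iota 0 k).
apply: (@runs_for_each _ _ _ L _ (fun=> True)) => // a u1 u2 b' e _; split=> //.
have -> : enc_seq (fun=> TNil) (a :: u2) = enc_nat (size u2).+1.
  rewrite (enc_natE _ 0); elim: u2 a 0 {e} => //= c u2 IH a j.
  by rewrite (IH c j.+1).
exact: step.
Qed.

Lemma runs_rounds n k v2 v3 v5 :
  let v0 := TCons (enc_nat n) (enc_nat k) in
  runs rounds_com
    [:: v0; enc_nat k.-1; v2; v3; TNil; v5; TNil; TNil]
    [:: v0; TNil; v2; v3; enc_nat (num_rounds n k); v5; TNil; TNil]
    (200 * n.+1 * k.+1 ^ 2).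
Proof.
move=> v0.
pose L7 v1 v6 x m := [:: v0; v1; v2; v3; enc_nat m; v5; v6; x].
have run7 v1 v6 m : runs (for_each 7 (4 ::= iter 24 (ECons ENil) 4))
   (L7 v1 v6 (enc_nat n) m) (L7 v1 v6 TNil (n * 24 + m)) (65 * n.+1).
  have -> : n * 24 + m = iter n (addn 24) m.
    by elim: (n) => //= j <-; rewrite mulSn addnA.
  apply: (@runs_repeat _ (L7 v1 v6) (addn 24) 7 _ 60) => // j b.
  by apply: runs_le; first exact: runs_assign.
pose L6 v1 x m := [:: v0; v1; v2; v3; enc_nat m; v5; x; TNil].
have run6 v1 m :
   runs (for_each 6 (7 ::= EHd 0 ;; for_each 7 (4 ::= iter 24 (ECons ENil) 4)))
   (L6 v1 (enc_nat k) m) (L6 v1 TNil (k * (n * 24) + m)) ((75 * n.+1) * k.+1).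
  have -> : k * (n * 24) + m = iter k (addn (n * 24)) m.
    by elim: (k) => //= j <-; rewrite mulSn addnA.
  apply: runs_le.
    apply: (@runs_repeat _ (L6 v1) (addn (n * 24)) 6 _ (70 * n.+1)) => // j b.
    apply: runs_le; first by run_assign; exact: run7.
    by rewrite /=; lia.
  by rewrite leq_mul2r; apply/orP; right; lia.
pose L1 x m := [:: v0; x; v2; v3; enc_nat m; v5; TNil; TNil].
have -> : num_rounds n k = iter k.-1 (addn (k * (n * 24))) 0.
  by rewrite /num_rounds -[LHS]addn0; elim: (k.-1) => //= j <-; rewrite mulSn addnA.
apply: runs_le.
  apply: (@runs_repeat _ L1 (addn (k * (n * 24))) 1 _ (80 * n.+1 * k.+1) k.-1 0) => // j b.
  apply: runs_le; first by run_assign; exact: run6.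
  by rewrite /=; nia.
rewrite -mulnn; case: (k) => [|k'] /=; nia.
Qed.

Lemma runs_generator n k :
  runs generator_com [:: TCons (enc_nat n) (enc_nat k)]
    [:: TCons (enc_nat (num_rounds n k))
          (TCons (enc_seq enc_pair_gate [seq (i, n + i) | i <- iota 0 n]) TNil);
        TNil; enc_nat n; enc_seq enc_pair_gate [seq (i, n + i) | i <- iota 0 n];
        enc_nat (num_rounds n k); TNil]
    (500 * n.+1 * k.+1 ^ 2).
Proof.
set v0 := TCons _ _.
pose pad := [:: TNil; TNil; TNil; TNil; TNil; TNil; TNil].
apply: (@eq_runs _ (v0 :: pad) _ ([:: TCons (enc_nat (num_rounds n k))
          (TCons (enc_seq enc_pair_gate [seq (i, n + i) | i <- iota 0 n]) TNil);
        TNil; enc_nat n; enc_seq enc_pair_gate [seq (i, n + i) | i <- iota 0 n];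
        enc_nat (num_rounds n k); TNil; TNil; TNil])).
- by case=> //; do 7 case => //; move=> i; rewrite /= !nth_nil.
- by do 8 case => //; move=> i; rewrite /= !nth_nil.
pose L2 x m := [:: v0; x; enc_nat m; TNil; TNil; TNil; TNil; TNil].
have run2 : runs (for_each 1 (2 ::= ECons ENil 2)) (L2 (enc_nat n) n)
    (L2 TNil (n + n)) (9 * n.+1).
  have -> : n + n = iter n S n by elim: {1 3}n => //= j <-.
  apply: (@runs_repeat _ L2 S 1 _ 4) => // j b.
  by apply: runs_le; first exact: runs_assign.
pose L x (p : nat * nat * seq (nat * nat)) :=
   [:: v0; x; enc_nat p.1.2; enc_seq enc_pair_gate p.2; TNil; enc_nat p.1.1; TNil; TNil].
pose F (p : nat * nat * seq (nat * nat)) :=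
  (p.1.1.-1, p.1.2.-1, (p.1.1.-1, p.1.2.-1) :: p.2).
have iterF m l j : iter j F (j, m + j, l) = (0, m, [seq (i, m + i) | i <- iota 0 j] ++ l).
  elim: j l => [|j IH] l; first by rewrite addn0.
  have -> : iota 0 j.+1 = iota 0 j ++ [:: j] by rewrite -addn1 iotaD.
  by rewrite map_cat -catA iterSr /F /= addnS /= IH.
have run3 : runs (for_each 1 (5 ::= ETl 5 ;; 2 ::= ETl 2 ;;
    3 ::= ECons (ECons (ECons ENil ENil) (ECons ENil (ECons 5 (ECons 2 ENil)))) 3))
    (L (enc_nat n) (n, n + n, [::])) (L TNil (iter n F (n, n + n, [::]))) (50 * n.+1).
  apply: (@runs_repeat _ L F 1 _ 45) => // j [[q r] l].
  apply: runs_le.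
    do 2 run_assign; case: q => [|q]; case: r => [|r]; exact: runs_assign.
  by [].
rewrite iterF cats0 in run3.
apply: runs_le.
  do 2 run_assign.
  eapply runs_seq; first exact: run2.
  do 2 run_assign.
  eapply runs_seq; first exact: run3.
  run_assign.
  have -> : tl (enc_nat k) = enc_nat k.-1 by case: (k).
  eapply runs_seq; first exact: runs_rounds.
  exact: runs_assign.
rewrite /=; nia.
Qed.

End Programs.

(** * Labels from samples *)

Notation "\xor_ ( i < n ) F" := (\big[addb/false]_(i < n) F)
  (at level 41, F at level 41, i, n at level 50).

(* [a] lists the outcomes on the first copy, followed by those on the second. *)
Definition singlet_bit (n : nat) (a : seq bool) (i : nat) : bool :=
  nth false a i && ~~ nth false a (n + i).

Definition entry (C : seq (seq bool)) (i q : nat) : bool :=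
  nth false (nth [::] C i) q.

Lemma nth_syndrome C a q :
  nth false (syndrome C a) q =
  \xor_(i < size C) (singlet_bit (size C) a i && entry C i q).
Proof.
rewrite /syndrome.
suff gen : forall d b, nth false (foldl syndrome_step (d, a, b) C).1.1 q =
   nth false d q (+) \xor_(i < size C) ((nth false a i && ~~ nth false b i) && entry C i q).
  rewrite gen nth_nil addFb; apply: eq_bigr => i _.
  by rewrite /singlet_bit nth_drop.
elim: C a => [|c C IH] a d b /=; first by rewrite big_ord0 addbF.
rewrite IH big_ord_recl /= addbA !nth0; congr (_ (+) _).
  by case: ifP => _; rewrite ?nth_xorl ?addbF.
by apply: eq_bigr => i _; rewrite /entry /= !nth_behead.
Qed.

Lemma nth_index_true (d : seq bool) : nth false d (index true d) = (true \in d).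
Proof.
case: (boolP (true \in d)) => [/nth_index -> //|h].
by rewrite nth_default // memNindex.
Qed.

(** The update v |-> v + v_p d, with p the pivot of d, in a single formula; the factor [true \in d]
    makes it the identity for d = 0. *)
Lemma entry_reduce C a i q : i < size C ->
  let d := syndrome C a in
  entry (reduce C a) i q =
  entry C i q (+) (entry C i (index true d) && ((true \in d) && nth false d q)).
Proof.
move=> lt_i d; rewrite /entry /reduce (nth_map [::]) // -/d /eliminate /pivot_bit.
case: (true \in d) => /=; last by rewrite andbF addbF.
by case: (nth false _ (index true d)); rewrite /= ?addbF // nth_xorl.
Qed.

(* [C] represents the linear map sending e_i to its i-th column.  It kills all
   samples of [S], and changes vectors only by elements of the span of [S], whence
   it is invariant under every functional vanishing on [S].  A coordinate is a
   pivot, hence zero in every column, or else its own unit vector is a column. *)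
Definition reduced (n : nat) (S : seq (seq bool)) (C : seq (seq bool)) : Prop :=
  [/\ size C = n,
      forall a q, a \in S -> \xor_(i < n) (singlet_bit n a i && entry C i q) = false,
      forall X : 'I_n -> bool,
        (forall a, a \in S -> \xor_(i < n) (X i && singlet_bit n a i) = false) ->
        forall i : 'I_n, \xor_(q < n) (X q && entry C i q) = X i &
      forall q : 'I_n, (forall q', entry C q q' = (q' == q)) \/
        (forall i : 'I_n, entry C i q = false)].

Lemma entry_unit_columns n i q : i < n -> entry (unit_columns n) i q = (q == i).
Proof.
move=> lt_i; rewrite /entry (nth_map 0) ?size_iota // nth_iota // /unit_column.
rewrite nth_rcons size_nseq nth_nseq.
by case: ltngtP => // ->; rewrite eqxx.
Qed.

Lemma reduced_unit_columns n : reduced n [::] (unit_columns n).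
Proof.
split=> //; first by rewrite size_map size_iota.
- move=> X _ i; rewrite (bigD1 i) //= entry_unit_columns // eqxx andbT.
  rewrite big1 ?addbF // => q neq_q.
  by rewrite entry_unit_columns // [_ == _](negbTE neq_q) andbF.
- by move=> q; left=> q'; rewrite entry_unit_columns.
Qed.

(** The new map is the old one followed by v |-> v + v_p d, where d is the image of [a] and p its
    pivot. This kills d. A functional X vanishing on the samples, [a] included, satisfies X d = X a
    = 0 by the old invariance, so it is invariant again. Coordinate p becomes zero everywhere; a
    column e_q with q != p has no entry at p and stays, and a coordinate that is zero in all columns
    is zero in d. *)
Lemma reduced_reduce n S C a : reduced n S C -> reduced n (rcons S a) (reduce C a).
Proof.
move=> [sizeC kerS perpS pivS]; set d := syndrome C a.
have dE q : nth false d q = \xor_(i < n) (singlet_bit n a i && entry C i q).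
  by rewrite nth_syndrome sizeC.
have redE i q (lt_i : i < n) := @entry_reduce C a i q (leq_trans lt_i (eq_leq (esym sizeC))).
split; first by rewrite size_map.
- move=> b q; rewrite mem_rcons inE => b_in.
  under eq_bigr => i _ do rewrite redE // -/d andb_addr andbA.
  rewrite big_split /= -big_distrl /=.
  case/predU1P: b_in => [->|b_in]; last by rewrite !kerS.
  (* The image of [a] is now d + d_p d, and d_p = 1 unless d = 0. *)
  rewrite -!dE nth_index_true.
  case: (boolP (true \in d)) => /= [_|h]; first by rewrite addbb.
  rewrite addbF; apply: contraNF h => h; rewrite -h mem_nth //.
  by rewrite ltnNge; apply/negP => le; rewrite nth_default in h.
- move=> X perpX i.
  have perpX' b : b \in S -> \xor_(i < n) (X i && singlet_bit n b i) = false.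
    by move=> b_in; apply: perpX; rewrite mem_rcons inE b_in orbT.
  transitivity (\xor_(q < n) ((X q && entry C i q) (+)
      ((entry C i (index true d) && (true \in d)) && (X q && nth false d q)))).
    apply: eq_bigr => q _; rewrite redE // -/d.
    by case: (X q); case: (entry C i q); case: (entry C i _); case: (true \in d).
  rewrite big_split /= perpS // -big_distrr /=.
  under [X in _ && X]eq_bigr => q _ do rewrite dE big_distrr /=.
  rewrite exchange_big /=.
  under [X in _ && X]eq_bigr => j _.
    under eq_bigr => q _ do rewrite andbCA.
    rewrite -big_distrr /= perpS // andbC. over.
  by rewrite perpX ?mem_rcons ?mem_head // !andbF addbF.
- move=> q; case: (pivS q) => [unit_q|zero_q]; last first.
    right=> i; rewrite redE // zero_q -/d dE big1 ?andbF // => j _.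
    by rewrite zero_q andbF.
  case: (eqVneq (index true d) q) => [eq_q|neq_q].
    case: (boolP (true \in d)) => [in_d|nin_d].
      right=> i; rewrite redE // -/d -eq_q nth_index_true in_d !andbT addbb //.
    by left=> q'; rewrite redE // -/d (negbTE nin_d) andbF addbF.
  by left=> q'; rewrite redE // -/d !unit_q (negbTE neq_q) addbF.
Qed.

Lemma reduced_foldl n S : reduced n S (foldl reduce (unit_columns n) S).
Proof.
elim/last_ind: S => [|S a IH]; first exact: reduced_unit_columns.
by rewrite -cats1 foldl_cat /= cats1; apply: reduced_reduce.
Qed.

(** The unions of blocks, expressed without choosing the blocks. *)
Definition saturated (n : nat) (P : {set {set 'I_n}}) (X : {set 'I_n}) : bool :=
  [forall i, forall j, (j \in pblock P i) ==> ((i \in X) == (j \in X))].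

Lemma saturatedP n (P : {set {set 'I_n}}) (X : {set 'I_n}) :
  reflect (forall i j, j \in pblock P i -> (i \in X) = (j \in X)) (saturated P X).
Proof.
apply: (iffP forallP) => [h i j ij|h i].
  by apply/eqP; move/forallP: (h i) => /(_ j) /implyP; apply.
by apply/forallP => j; apply/implyP => ij; apply/eqP; apply: h.
Qed.

(** By hypothesis the functionals vanishing on [S] are the indicators of unions of blocks. Every
    coordinate of the columns is such a functional, so columns agree along a block. The indicator of
    the block of i is another one, so by invariance column i has an odd number of ones at
    coordinates of this block; for such a coordinate q the column of q is e_q, and column i equals
    it. *)
Lemma identifies_labels n (P : {set {set 'I_n}}) (S : seq (seq bool)) :
  partition P [set: 'I_n] ->
  (forall X : {set 'I_n},
    saturated P X <->
    forall a, a \in S -> \xor_(i < n) ((i \in X) && singlet_bit n a i) = false) ->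
  identifies (labels n S) P.
Proof.
move=> partP satP; rewrite /identifies /labels; set C := foldl _ _ _.
have [sizeC kerS perpS pivS] : reduced n S C := reduced_foldl n S.
have trivP := partition_trivIset partP.
have inP (i : 'I_n) : i \in pblock P i by rewrite mem_pblock (cover_partition partP).
rewrite size_map sizeC eqxx /=.
have same_col (i j : 'I_n) : j \in pblock P i -> forall q, entry C i q = entry C j q.
  move=> ij q; pose X := [set i : 'I_n | entry C i q].
  have /satP/saturatedP/(_ _ _ ij) : forall a, a \in S ->
      \xor_(i < n) ((i \in X) && singlet_bit n a i) = false.
    move=> a aS; rewrite -[RHS](kerS a q aS); apply: eq_bigr => k _.
    by rewrite inE andbC.
  by rewrite !inE.
have col_unit (i : 'I_n) : exists2 q : 'I_n, q \in pblock P i &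
    forall q', entry C i q' = (q' == q).
  have satA : saturated P (pblock P i).
    apply/saturatedP => j k jk.
    by apply/idP/idP => h; rewrite -(same_pblock trivP h) ?(same_pblock trivP jk) ?inP //
       -(same_pblock trivP jk).
  have /(_ i) := perpS (fun i' => i' \in pblock P i) (iffLR (satP _) satA).
  rewrite inP => sum_true.
  have /existsP[q /andP[qi iq]] : [exists q : 'I_n, (q \in pblock P i) && entry C i q].
    apply: contraT => /existsPn h; move: sum_true; rewrite big1 // => q _.
    exact: negbTE.
  exists q => // q'; rewrite (same_col _ _ qi).
  by case: (pivS q) => [->|/(_ i)] //; rewrite iq.
have labelE (i : 'I_n) : exists2 q : 'I_n, q \in pblock P i &
    (forall q', entry C i q' = (q' == q)) /\ nth 0 (map (index true) C) i = q.
  have [q qi hq] := col_unit i; exists q => //; split=> //.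
  rewrite (nth_map [::]) ?sizeC //.
  have hq' := hq : forall q', nth false (nth [::] C i) q' = (q' == q).
  have in_c : true \in nth [::] C i.
    rewrite -(eqxx (q : nat)) -hq' mem_nth // ltnNge; apply/negP => le.
    by have := hq' q; rewrite eqxx nth_default.
  by have := nth_index_true (nth [::] C i); rewrite hq' in_c => /eqP.
apply/eqP; rewrite -[RHS](equivalence_partition_pblock partP).
apply: eq_in_imset => i _; apply/setP => j; rewrite !inE /=.
have [q qi [hq ->]] := labelE i; have [r rj [hr ->]] := labelE j.
apply/eqP/idP => [eq_qr|ij].
  have eq_q : q = r by apply: val_inj.
  by rewrite -(same_pblock trivP qi) eq_q (same_pblock trivP rj).
by have := hq r; rewrite (same_col _ _ ij) hr eqxx => /esym/eqP ->.
Qed.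

Local Open Scope ring_scope.

(** * Purity *)

Section Purity.
Variable R : realType.
Local Notation rc := (real_complex R).
Implicit Types (z w : R[i]) (eps : R).

Lemma sqmod_norm z : rc (sqmod z) = `|z| ^+ 2.
Proof. by rewrite rmorphXn. Qed.

Lemma sqmodE z : rc (sqmod z) = z^* * z.
Proof. by rewrite sqmod_norm normCK mulrC. Qed.

Lemma sqmod_ge0 z : 0 <= sqmod z.
Proof. exact: sqr_ge0. Qed.

Lemma sqmodM z w : sqmod (z * w) = sqmod z * sqmod w.
Proof. by rewrite /sqmod ComplexField.Normc.normcM exprMn. Qed.

Lemma sqmod0 : sqmod (0 : R[i]) = 0.
Proof. by rewrite /sqmod ComplexField.Normc.normc0 expr0n. Qed.

Lemma sqmod1 : sqmod (1 : R[i]) = 1.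
Proof. by rewrite /sqmod ComplexField.Normc.normc1 expr1n. Qed.

Lemma sqmod_eq0 z : (sqmod z == 0) = (z == 0).
Proof.
apply/idP/eqP => [|->]; last by rewrite sqmod0.
by rewrite sqrf_eq0 => /eqP /ComplexField.Normc.eq0_normc.
Qed.

Lemma sqmod_conj z : sqmod z^* = sqmod z.
Proof. by apply: (@complexI R); rewrite /= !sqmodE conjCK mulrC. Qed.

Lemma sqmod_real (x : R) : sqmod (rc x) = x ^+ 2.
Proof.
apply: (@complexI R); rewrite /= sqmod_norm -[RHS]/(rc (x ^+ 2)) rmorphXn.
by rewrite -normrX ger0_norm // -rmorphXn lecR sqr_ge0.
Qed.

(** Lagrange's identity: the sum of all (a_i b_j - a_j b_i)^2 is twice the difference of the two
    sides. *)
Lemma cauchy_schwarz_real (I : finType) (a b : I -> R) :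
  (\sum_i a i * b i) ^+ 2 <= (\sum_i a i ^+ 2) * (\sum_i b i ^+ 2).
Proof.
have : 0 <= \sum_i \sum_j (a i * b j - a j * b i) ^+ 2.
  by apply: sumr_ge0 => i _; apply: sumr_ge0 => j _; apply: sqr_ge0.
suff -> : \sum_i \sum_j (a i * b j - a j * b i) ^+ 2 =
    2%:R * ((\sum_i a i ^+ 2) * (\sum_i b i ^+ 2) - (\sum_i a i * b i) ^+ 2).
  by rewrite pmulr_rge0 ?subr_ge0.
transitivity (\sum_i \sum_j (a i ^+ 2 * b j ^+ 2 + b i ^+ 2 * a j ^+ 2
   - 2%:R * ((a i * b i) * (a j * b j)))).
  by apply: eq_bigr => i _; apply: eq_bigr => j _; ring.
under eq_bigr => i _ do rewrite sumrB big_split /= -mulr_sumr -mulr_sumr -mulr_sumr -mulr_sumr.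
rewrite sumrB big_split /= -!mulr_suml -mulr_sumr -mulr_suml; ring.
Qed.

Lemma cauchy_schwarz (I : finType) (x y : I -> R[i]) :
  sqmod (\sum_i x i * y i) <= (\sum_i sqmod (x i)) * (\sum_i sqmod (y i)).
Proof.
pose a i := ComplexField.Normc.normc (x i).
pose b i := ComplexField.Normc.normc (y i).
apply: le_trans (cauchy_schwarz_real a b).
have h : ComplexField.Normc.normc (\sum_i x i * y i) <= \sum_i a i * b i.
  rewrite -lecR -[leLHS]/(`|\sum_i x i * y i|).
  apply: le_trans (ler_norm_sum _ _ _) _; rewrite rmorph_sum /=; apply: ler_sum => i _.
  by rewrite normrM rmorphM.
have h0 z : 0 <= ComplexField.Normc.normc z by case: z => p q; apply: sqrtr_ge0.
by rewrite /sqmod lerXn2r // nnegrE // (le_trans _ h).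
Qed.

Section Join.
Variable (Q : finType) (B : {set Q}).
Local Notation bitsB := (bits {x : Q | x \in B}).
Local Notation bitsC := (bits {x : Q | x \in ~: B}).

(** The final [false] is never reached, since every qubit lies in [B] or in its complement. *)
Definition join (u : bitsB) (v : bitsC) : bits Q :=
  [ffun x => if insub x is Some y then u y
             else if insub x is Some y then v y else false].

Lemma restr_joinl u v : restr B (join u v) = u.
Proof. by apply/ffunP => x; rewrite !ffunE valK. Qed.

Lemma restr_joinr u v : restr (~: B) (join u v) = v.
Proof.
apply/ffunP => x; rewrite !ffunE valK insubF //.
by apply/negbTE; have := valP x; rewrite inE.
Qed.

Lemma join_restr b : join (restr B b) (restr (~: B) b) = b.
Proof.
apply/ffunP => x; rewrite !ffunE; case: insubP => [y _ <-|xB].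
  by rewrite ffunE.
by rewrite insubT ?inE // => xC; rewrite ffunE.
Qed.

Lemma sum_bits_split (V : nmodType) (F : bits Q -> V) :
  \sum_b F b = \sum_u \sum_v F (join u v).
Proof.
rewrite pair_big /= (reindex (fun p => join p.1 p.2)) //=.
exists (fun b => (restr B b, restr (~: B) b)) => [[u v]|b] _ /=.
  by rewrite restr_joinl restr_joinr.
exact: join_restr.
Qed.

End Join.

Definition mix (Q : finType) (X : {set Q}) (b c : bits Q) : bits Q :=
  [ffun i => if i \in X then c i else b i].

(** This is <v v|SWAP_X|v v> in coordinates: the pair ([mix X b c], [mix X c b]) arises from (b, c)
    by exchanging the bits in [X]. *)
Definition purity (Q : finType) (v : vec R Q) (X : {set Q}) : R[i] :=
  \sum_b \sum_c (v b)^* * (v c)^* * (v (mix X b c) * v (mix X c b)).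

Lemma mixK (Q : finType) (X : {set Q}) b c : mix X (mix X b c) (mix X c b) = b.
Proof. by apply/ffunP => i; rewrite !ffunE; case: (i \in X). Qed.

Lemma sum_mix (Q : finType) (X : {set Q}) (F : bits Q -> bits Q -> R) :
  \sum_b \sum_c F (mix X b c) (mix X c b) = \sum_b \sum_c F b c.
Proof.
pose swap (p : bits Q * bits Q) := (mix X p.1 p.2, mix X p.2 p.1).
rewrite !pair_big /= [RHS](reindex swap) //=.
by exists swap => -[b c] _ /=; rewrite /swap !mixK.
Qed.

(** The distance hypothesis speaks of unit product states; rescaling extends it to all vectors alpha
    beta whose factors depend only on the bits inside, respectively outside, [B]. The zero vector
    cannot be rescaled and is treated apart. *)
Lemma far_inner (Q : finType) (eps : R) (phi : vec R Q) (B : {set Q})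
    (alpha beta : bits Q -> R[i]) :
  0 < eps -> B != set0 -> ~: B != set0 -> far_from_product eps phi ->
  (forall b b' : bits Q, (forall x, x \in B -> b x = b' x) -> alpha b = alpha b') ->
  (forall b b' : bits Q, (forall x, x \in ~: B -> b x = b' x) -> beta b = beta b') ->
  sqmod (inner phi [ffun b => alpha b * beta b]) <=
    (1 - eps ^+ 2) * \sum_b sqmod (alpha b * beta b).
Proof.
move=> eps_gt0 B0 C0 far alphaB betaC.
pose u0 : bits {x : Q | x \in B} := [ffun=> false].
pose v0 : bits {x : Q | x \in ~: B} := [ffun=> false].
pose a u := alpha (join u v0); pose c v := beta (join u0 v).
have alphaE b : alpha b = a (restr B b).
  apply: alphaB => x xB; have /ffunP/(_ (exist _ x xB)) := restr_joinl (restr B b) v0.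
  by rewrite [LHS]ffunE [RHS]ffunE.
have betaE b : beta b = c (restr (~: B) b).
  apply: betaC => x xB; have /ffunP/(_ (exist _ x xB)) := restr_joinr u0 (restr (~: B) b).
  by rewrite [LHS]ffunE [RHS]ffunE.
pose na := \sum_u sqmod (a u); pose nc := \sum_v sqmod (c v).
have normE : \sum_b sqmod (alpha b * beta b) = na * nc.
  rewrite (sum_bits_split B) mulr_suml; apply: eq_bigr => u _.
  rewrite mulr_sumr; apply: eq_bigr => v _.
  by rewrite alphaE betaE restr_joinl restr_joinr sqmodM.
have na_ge0 : 0 <= na by apply: sumr_ge0 => u _; apply: sqmod_ge0.
have nc_ge0 : 0 <= nc by apply: sumr_ge0 => u _; apply: sqmod_ge0.
rewrite normE; have [n0|n0] := eqVneq (na * nc) 0.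
  rewrite n0 mulr0 /inner big1 ?sqmod0 // => b _.
  rewrite n0 in normE; have /eqP := normE.
  rewrite psumr_eq0 => [/allP/(_ b)|? _]; last exact: sqmod_ge0.
  rewrite mem_index_enum => /(_ isT) /=; rewrite sqmod_eq0 ffunE => /eqP ->.
  by rewrite mulr0.
have /norP[na0 nc0] : ~~ ((na == 0) || (nc == 0)) by rewrite -mulf_eq0.
have unit_scale (I : finType) (f : I -> R[i]) : \sum_i sqmod (f i) != 0 ->
   \sum_i sqmod (rc (Num.sqrt (\sum_i sqmod (f i)))^-1 * f i) = 1.
  move=> f0; under eq_bigr => i _ do rewrite sqmodM sqmod_real.
  rewrite -mulr_sumr exprVn sqr_sqrtr ?mulVf //.
  by apply: sumr_ge0 => i _; apply: sqmod_ge0.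
pose a' : vec R {x : Q | x \in B} := [ffun u => rc (Num.sqrt na)^-1 * a u].
pose c' : vec R {x : Q | x \in ~: B} := [ffun v => rc (Num.sqrt nc)^-1 * c v].
pose w : vec R Q := [ffun b => a' (restr B b) * c' (restr (~: B) b)].
have prod_w : is_product_state w.
  exists B; split=> //; exists a', c'; split; last by move=> b; rewrite ffunE.
  - by rewrite /unit_vec -[RHS](unit_scale _ a na0); apply: eq_bigr => u _; rewrite ffunE.
  - by rewrite /unit_vec -[RHS](unit_scale _ c nc0); apply: eq_bigr => u _; rewrite ffunE.
have innerE : inner phi w = rc ((Num.sqrt na)^-1 * (Num.sqrt nc)^-1) *
   inner phi [ffun b => alpha b * beta b].
  rewrite /inner mulr_sumr; apply: eq_bigr => b _; rewrite !ffunE -alphaE -betaE rmorphM /=.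
  ring.
have := far w prod_w; rewrite /trace_dist innerE sqmodM.
rewrite sqmod_real exprMn !exprVn !sqr_sqrtr //.
set s := sqmod _ => le_eps.
have nn_gt0 : 0 < na * nc by rewrite lt_def n0 mulr_ge0.
have : eps ^+ 2 <= 1 - na^-1 * nc^-1 * s.
  (* [Num.sqrt] is 0 on negative numbers; [0 < eps] excludes that case, so both sides can be
     squared. *)
  have pos : 0 < Num.sqrt (1 - na^-1 * nc^-1 * s) by apply: lt_le_trans le_eps.
  rewrite sqrtr_gt0 in pos.
  by rewrite -(sqr_sqrtr (ltW pos)) lerXn2r // nnegrE ?sqrtr_ge0 ?ltW.
by rewrite -invfM [_^-1 * s]mulrC lerBrDr -lerBrDl ler_pdivrMr.
Qed.

(* Up to normalisation, each [b |-> v (mix X b c) * v (mix X c b)] is a product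
   state across X, so [far_inner] applies to every term. *)
Lemma purity_inner (Q : finType) (v : vec R Q) (X : {set Q}) :
  purity v X = \sum_c (v c)^* * inner v [ffun b => v (mix X b c) * v (mix X c b)].
Proof.
rewrite /purity exchange_big /=; apply: eq_bigr => c _.
rewrite /inner mulr_sumr; apply: eq_bigr => b _; rewrite ffunE; ring.
Qed.

(** Cauchy-Schwarz over [c] against the unit vector v. Exchanging bits on [X] permutes the pairs (b,
    c), so the squared norms of the inner vectors add up to that of two copies of v, which is 1. *)
Lemma sqmod_purity_le (Q : finType) (v : vec R Q) (X : {set Q}) (K : R) :
  unit_vec v ->
  (forall c, sqmod (inner v [ffun b => v (mix X b c) * v (mix X c b)]) <=
    K * \sum_b sqmod (v (mix X b c) * v (mix X c b))) ->
  sqmod (purity v X) <= K.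
Proof.
move=> unit_v h; rewrite purity_inner; apply: le_trans (cauchy_schwarz _ _) _.
under eq_bigr => c _ do rewrite sqmod_conj.
rewrite [X in X * _]unit_v mul1r; apply: le_trans (ler_sum _ (fun c _ => h c)) _.
rewrite -mulr_sumr exchange_big /=.
under eq_bigr => b _ do under eq_bigr => c _ do rewrite sqmodM.
rewrite (sum_mix X (fun b c => sqmod (v b) * sqmod (v c))).
under eq_bigr => b _ do rewrite -mulr_sumr unit_v mulr1.
by rewrite unit_v mulr1.
Qed.

Lemma sqmod_purity_le1 (Q : finType) (v : vec R Q) (X : {set Q}) :
  unit_vec v -> sqmod (purity v X) <= 1.
Proof.
move=> unit_v; apply: sqmod_purity_le => // c; rewrite /inner mul1r.
apply: le_trans (cauchy_schwarz _ _) _.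
under eq_bigr => b _ do rewrite sqmod_conj.
rewrite [X in X * _]unit_v mul1r.
by under eq_bigr => b _ do rewrite ffunE.
Qed.

Lemma far_sqmod_purity (Q : finType) (eps : R) (v : vec R Q) (X : {set Q}) :
  0 < eps -> unit_vec v -> far_from_product eps v -> X != set0 -> ~: X != set0 ->
  sqmod (purity v X) <= 1 - eps ^+ 2.
Proof.
move=> eps_gt0 unit_v far X0 C0; apply: sqmod_purity_le => // c.
(* As functions of b, [v (mix X b c)] reads only the bits outside [X] and [v (mix X c b)] only those
   in [X]. *)
have := @far_inner Q eps v (~: X) (fun b => v (mix X b c)) (fun b => v (mix X c b)).
apply=> //; rewrite ?setCK // => b b' eqb; congr (v _); apply/ffunP => i; rewrite !ffunE.
  by case: ifPn => // iX; apply: eqb; rewrite inE.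
by case: ifP => // iX; apply: eqb.
Qed.

End Purity.

(** * Purity of many-cut states *)

Section ManyCut.
Variable R : realType.
Local Notation rc := (real_complex R).

(** A basis vector in the support of phi is a product state across [B] and has nonzero overlap with
    phi. *)
Lemma far_lt1 (Q : finType) (eps : R) (phi : vec R Q) (B : {set Q}) :
  0 < eps -> unit_vec phi -> B != set0 -> ~: B != set0 ->
  far_from_product eps phi -> eps < 1.
Proof.
move=> eps_gt0 unit_phi B0 C0 far.
have [b phib] : exists b, phi b != 0.
  apply/existsP; apply: contraT => /existsPn h.
  have /eqP := unit_phi; rewrite big1 => [|b _]; first by rewrite eq_sym oner_eq0.
  by move: (h b); rewrite negbK => /eqP ->; rewrite sqmod0.
pose ind (A : {set Q}) (b' : bits Q) : R[i] := [forall x in A, b' x == b x]%:R.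
have indE b' : ind B b' * ind (~: B) b' = (b' == b)%:R.
  rewrite -natrM mulnb; congr (_%:R); congr (nat_of_bool _).
  apply/andP/eqP => [[/forall_inP h1 /forall_inP h2]|->]; last first.
    by split; apply/forall_inP.
  apply/ffunP => x; apply/eqP; have [xB|xB] := boolP (x \in B); first exact: h1.
  by apply: h2; rewrite inE.
have ind_local (A : {set Q}) (b1 b2 : bits Q) :
    (forall x, x \in A -> b1 x = b2 x) -> ind A b1 = ind A b2.
  move=> h; congr (_%:R); congr (nat_of_bool _).
  by apply: eq_forallb => x; case: (boolP (x \in A)) => //= /h ->.
have := far_inner eps_gt0 B0 C0 far (ind_local B) (ind_local (~: B)).
have -> : inner phi [ffun b' => ind B b' * ind (~: B) b'] = (phi b)^*.
  rewrite /inner (bigD1 b) //= ffunE indE eqxx mulr1 big1 ?addr0 // => b' neq.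
  by rewrite ffunE indE (negbTE neq) mulr0.
rewrite (bigD1 b) //= indE eqxx sqmod1 big1 ?addr0 => [|b' neq]; last first.
  by rewrite indE (negbTE neq) sqmod0.
rewrite mulr1 sqmod_conj => le1.
have gt0 : 0 < sqmod (phi b) by rewrite lt_def sqmod_eq0 phib sqmod_ge0.
have : eps ^+ 2 < 1 by rewrite -subr_gt0; apply: lt_le_trans le1.
by rewrite expr_lt1 // ltW.
Qed.

Definition subpre (Q : finType) (A X : {set Q}) : {set {x : Q | x \in A}} :=
  [set x | val x \in X].

Lemma restr_mix (Q : finType) (A X : {set Q}) b c :
  restr A (mix X b c) = mix (subpre A X) (restr A b) (restr A c).
Proof. by apply/ffunP => x; rewrite !ffunE inE. Qed.

Lemma purity_split (Q : finType) (A X : {set Q}) (v : vec R Q)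
    (f : vec R {x | x \in A}) (h : vec R {x | x \in ~: A}) :
  (forall b, v b = f (restr A b) * h (restr (~: A) b)) ->
  purity v X = purity f (subpre A X) * purity h (subpre (~: A) X).
Proof.
move=> vE; rewrite /purity (sum_bits_split A) mulr_suml; apply: eq_bigr => u _.
transitivity (\sum_v0 \sum_u' \sum_v'
   ((f u)^* * (f u')^* * (f (mix (subpre A X) u u') * f (mix (subpre A X) u' u))) *
   ((h v0)^* * (h v')^* *
    (h (mix (subpre (~: A) X) v0 v') * h (mix (subpre (~: A) X) v' v0)))).
  apply: eq_bigr => v0 _; rewrite (sum_bits_split A); apply: eq_bigr => u' _.
  apply: eq_bigr => v' _; rewrite !vE !restr_mix !restr_joinl !restr_joinr !rmorphM /=.
  ring.
rewrite exchange_big /= mulr_suml; apply: eq_bigr => u' _.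
rewrite mulr_sumr; apply: eq_bigr => v0 _.
by rewrite mulr_sumr.
Qed.

Lemma unit_split (Q : finType) (A : {set Q}) (v : vec R Q)
    (f : vec R {x | x \in A}) (h : vec R {x | x \in ~: A}) :
  (forall b, v b = f (restr A b) * h (restr (~: A) b)) ->
  unit_vec v -> unit_vec f -> unit_vec h.
Proof.
move=> vE unit_v unit_f; rewrite /unit_vec -[RHS]unit_v (sum_bits_split A).
rewrite -[LHS]mul1r -[X in X * _]unit_f mulr_suml; apply: eq_bigr => u _.
rewrite mulr_sumr; apply: eq_bigr => w _.
by rewrite vE restr_joinl restr_joinr sqmodM.
Qed.

Section Instance.
Variables (n : nat) (eps : R) (P : {set {set 'I_n}}) (psi : vec R 'I_n).
Hypothesis inst : many_cut_instance eps P psi.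

Lemma cut_block (X : {set 'I_n}) : ~~ saturated P X ->
  exists A : {set 'I_n}, exists f : vec R {i | i \in A},
    exists h : vec R {i | i \in ~: A},
    [/\ unit_vec f, far_from_product eps f,
        forall b, psi b = f (restr A b) * h (restr (~: A) b),
        subpre A X != set0 & ~: subpre A X != set0].
Proof.
case: inst => partP unit_psi [phi [phiP psiE]].
case/forallPn=> i /forallPn[j].
rewrite negb_imply => /andP[ij neq]; set A := pblock P i in ij.
have inP (k : 'I_n) : k \in pblock P k by rewrite mem_pblock (cover_partition partP).
have AP : A \in P by apply: pblock_mem; rewrite (cover_partition partP).
have [unitA farA] := phiP A AP.
(* The other factors do not read the bits in [A], so any filling there will do. *)
pose h : vec R {i | i \in ~: A} := [ffun v =>
  \prod_(A' in P | A' != A) phi A' (restr A' (join [ffun=> false] v))].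
have iA : i \in A := inP i.
exists A, (phi A), h; split=> //.
- move=> b; rewrite psiE (bigD1 A) //= ffunE; congr (_ * _).
  apply: eq_bigr => A' /andP[A'P neqA]; congr (phi A' _).
  apply/ffunP => x; rewrite ![restr _ _ _]ffunE /=.
  have xA : val x \in ~: A.
    rewrite inE; apply: contra neqA => xA.
    by rewrite -(def_pblock (partition_trivIset partP) A'P (valP x))
      -(def_pblock (partition_trivIset partP) AP xA).
  have /ffunP/(_ (exist _ (val x) xA)) := restr_joinr [ffun=> false] (restr (~: A) b).
  by rewrite [LHS]ffunE [RHS]ffunE.
- apply/set0Pn; case: (boolP (i \in X)) neq => [iX _|_ jX].
    by exists (exist _ i iA); rewrite inE.
  by exists (exist _ j ij); rewrite inE /=; case: (j \in X) jX.
- apply/set0Pn; case: (boolP (i \in X)) neq => [_ jX|iX _].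
    by exists (exist _ j ij); rewrite !inE /=; case: (j \in X) jX.
  by exists (exist _ i iA); rewrite !inE.
Qed.

Lemma purity_cut (X : {set 'I_n}) : 0 < eps -> ~~ saturated P X ->
  sqmod (purity psi X) <= 1 - eps ^+ 2.
Proof.
move=> eps_gt0 /cut_block [A [f [h [unit_f far_f psiE X0 C0]]]].
have unit_h : unit_vec h by apply: unit_split psiE _ unit_f; case: inst.
rewrite (purity_split X psiE) sqmodM.
apply: le_trans (far_sqmod_purity eps_gt0 unit_f far_f X0 C0).
by rewrite ler_piMr ?sqmod_ge0 ?sqmod_purity_le1.
Qed.

(** Read contrapositively: for eps >= 1 every set is a union of blocks, so zero rounds suffice. *)
Lemma cut_lt1 (X : {set 'I_n}) : 0 < eps -> ~~ saturated P X -> eps < 1.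
Proof.
move=> eps_gt0 /cut_block [A [f [h [unit_f far_f _ X0 C0]]]].
exact: far_lt1 X0 C0 far_f.
Qed.

(** Every block lies in [X] or misses it, so exchanging the bits in [X] swaps or fixes the two
    arguments of each factor. *)
Lemma purity_saturated (X : {set 'I_n}) : saturated P X -> purity psi X = 1.
Proof.
case: inst => partP unit_psi [phi [_ psiE]] /saturatedP satX.
have swap b c : psi (mix X b c) * psi (mix X c b) = psi b * psi c.
  rewrite !psiE -!big_split; apply: eq_bigr => A AP /=.
  have inA (x y : {i | i \in A}) : (val x \in X) = (val y \in X).
    apply: satX; rewrite (def_pblock (partition_trivIset partP) AP (valP x)).
    exact: valP.
  have [/forallP allX|/forallPn[x xX]] := boolP [forall x : {i | i \in A}, val x \in X].
    have restrE b' c' : restr A (mix X b' c') = restr A c'.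
      by apply/ffunP => x; rewrite !ffunE allX.
    by rewrite !restrE mulrC.
  have restrE b' c' : restr A (mix X b' c') = restr A b'.
    by apply/ffunP => y; rewrite !ffunE (inA y x) (negbTE xX).
  by rewrite !restrE.
have norm1 : \sum_b (psi b)^* * psi b = 1.
  under eq_bigr do rewrite -sqmodE.
  by rewrite -rmorph_sum -[RHS](rmorph1 rc); congr (rc _).
rewrite /purity; under eq_bigr => b _ do under eq_bigr => c _ do rewrite swap mulrACA.
by under eq_bigr => b _ do rewrite -mulr_sumr norm1 mulr1.
Qed.

End Instance.
End ManyCut.

(** * The swap test *)

Section SwapTest.
Variable R : realType.
Local Notation rc := (real_complex R).

Definition half_root : R[i] := rc (Num.sqrt 2^-1).
Local Notation s := half_root.

Lemma half_root_sqr : s * s = 2^-1.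
Proof.
rewrite /s -rmorphM -expr2 sqr_sqrtr ?invr_ge0 ?ler0n //.
by rewrite fmorphV rmorph_nat.
Qed.

Lemma half_root_conj : s^* = s.
Proof. exact: conjc_real. Qed.

(* The singlet (|01> - |10>) / sqrt 2 is mapped to |10>. *)
Definition bell_gate : 'M[R[i]]_4 :=
  \matrix_(i, j) nth 0 (nth [::] [:: [:: 1; 0; 0; 0]; [:: 0; s; s; 0];
                                    [:: 0; s; - s; 0]; [:: 0; 0; 0; 1]] i) j.

Lemma bell_gate_unitary : bell_gate \is unitarymx.
Proof.
apply/unitarymxP/matrixP => i j; rewrite !mxE !big_ord_recl big_ord0 !mxE /=.
have sC : (- s)^* = - s by rewrite rmorphN /= half_root_conj.
case: i => [[|[|[|[|//]]]] i]; case: j => [[|[|[|[|//]]]] j];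
  rewrite /= ?half_root_conj ?sC ?rmorph0 ?rmorph1 ?mulr0 ?mul0r ?addr0 ?add0r
    ?mulrN ?mulNr ?opprK ?half_root_sqr ?mulr1 ?subrr //.
all: by field.
Qed.

Lemma bell_gate_algebraic i j :
  algebraicOver (ratr : rat -> R[i]) (bell_gate i j).
Proof.
have alg_s : algebraicOver (ratr : rat -> R[i]) s.
  exists ('X^2 - (2^-1)%:P); first by rewrite -size_poly_eq0 size_XnsubC.
  rewrite /root rmorphB /= map_polyXn map_polyC /= !hornerE.
  by rewrite expr2 half_root_sqr fmorphV rmorph_nat subrr.
rewrite mxE; case: i => [[|[|[|[|//]]]] i]; case: j => [[|[|[|[|//]]]] j];
  rewrite /=; try exact: algebraic0; try exact: algebraic1; try exact: alg_s.
exact: algebraic_opp.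
Qed.

Definition bell_gates : gate_set R.
Proof.
refine (@GateSet R 0 1 (fun=> 1%:M) (fun=> bell_gate) _ _ _ _).
- by case.
- by move=> _; exact: bell_gate_unitary.
- by case.
- by move=> _; exact: bell_gate_algebraic.
Defined.

Definition bell_layer (n : nat) (l : seq 'I_n) : layer bell_gates (n + n) :=
  [seq @App2 R bell_gates (n + n) ord0 (lshift n i) (rshift n i) | i <- l].

Variable n : nat.
Implicit Types (c d : bits 'I_n) (i j : 'I_n) (V W : bits 'I_n -> bits 'I_n -> R[i]).

Definition cat_bits c d : bits 'I_(n + n) :=
  [ffun k => match split k with inl i => c i | inr i => d i end].

Lemma cat_bitsl c d i : cat_bits c d (lshift n i) = c i.
Proof.
rewrite ffunE; case: splitP => k /= e; first by congr (c _); apply: val_inj.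
by have := ltn_ord i; rewrite e; lia.
Qed.

Lemma cat_bitsr c d i : cat_bits c d (rshift n i) = d i.
Proof.
rewrite ffunE; case: splitP => k /= e; first by have := ltn_ord k; rewrite -e; lia.
by congr (d _); apply: val_inj => /=; lia.
Qed.

Lemma sum_cat_bits (T : nmodType) (F : bits 'I_(n + n) -> T) :
  \sum_b F b = \sum_c \sum_d F (cat_bits c d).
Proof.
rewrite pair_big /= (reindex (fun p => cat_bits p.1 p.2)) //=.
pose halves (b : bits 'I_(n + n)) : bits 'I_n * bits 'I_n :=
  ([ffun i => b (lshift n i)], [ffun i => b (rshift n i)]).
exists halves => [[c d]|b] _ /=.
  by congr (_, _); apply/ffunP => i; rewrite ffunE ?cat_bitsl ?cat_bitsr.
apply/ffunP => k; case: (split_ordP k) => i ->.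
  by rewrite cat_bitsl ffunE.
by rewrite cat_bitsr ffunE.
Qed.

Lemma set_bit_catl c d i x :
  set_bit (cat_bits c d) (lshift n i) x = cat_bits (set_bit c i x) d.
Proof.
apply/ffunP => k; case: (split_ordP k) => j ->; rewrite ffunE.
  by rewrite !cat_bitsl ffunE eq_lshift.
by rewrite !cat_bitsr eq_rlshift.
Qed.

Lemma set_bit_catr c d i x :
  set_bit (cat_bits c d) (rshift n i) x = cat_bits c (set_bit d i x).
Proof.
apply/ffunP => k; case: (split_ordP k) => j ->; rewrite ffunE.
  by rewrite !cat_bitsl eq_lrshift.
by rewrite !cat_bitsr ffunE eq_rshift.
Qed.

(** The gate on qubit [i] of both copies, with the joint state written as a function of two labels;
    this keeps [lshift] and [rshift] out of the inductions over gates. *)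
Definition bell_at i V c d : R[i] :=
  let w x y := V (set_bit c i x) (set_bit d i y) in
  match c i, d i with
  | false, false => w false false
  | false, true => s * (w false true + w true false)
  | true, false => s * (w false true - w true false)
  | true, true => w true true
  end.

Definition bell_run (l : seq 'I_n) V := foldl (fun V i => bell_at i V) V l.

Lemma bell_run_rcons l i V : bell_run (rcons l i) V = bell_at i (bell_run l V).
Proof. by rewrite /bell_run -cats1 foldl_cat. Qed.

Lemma run_gate_bell (v : vec R 'I_(n + n)) i c d :
  run_gate v (@App2 R bell_gates (n + n) ord0 (lshift n i) (rshift n i)) (cat_bits c d) =
  bell_at i (fun c d => v (cat_bits c d)) c d.
Proof.
rewrite ffunE !big_bool /= !set_bit_catl !set_bit_catr cat_bitsl cat_bitsr /bell_at.
rewrite /bell_gate !mxE /idx2.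
by case: (c i); case: (d i); rewrite !inordK //= ?mul0r ?mul1r ?addr0 ?add0r
  ?mulNr ?mulrBr ?mulrDr // addrC.
Qed.

Lemma run_bell_layer (l : seq 'I_n) (v : vec R 'I_(n + n)) c d :
  foldl (@run_gate R bell_gates (n + n)) v (bell_layer l) (cat_bits c d) =
  bell_run l (fun c d => v (cat_bits c d)) c d.
Proof.
elim/last_ind: l c d => // l i IH c d.
rewrite bell_run_rcons /bell_layer map_rcons -cats1 foldl_cat /= run_gate_bell /bell_at.
by rewrite !IH.
Qed.

Lemma sum_set_bit (T : nmodType) i (G : bits 'I_n -> T) :
  \sum_c \sum_(x : bool) G (set_bit c i x) = (\sum_c G c) *+ 2.
Proof.
pose flip c := set_bit c i (~~ c i).
have flipK : involutive flip.
  by move=> c; apply/ffunP => j; rewrite !ffunE eqxx negbK; case: eqP => // ->.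
have id_bit c : set_bit c i (c i) = c.
  by apply/ffunP => j; rewrite ffunE; case: eqP => // ->.
transitivity (\sum_c (G c + G (flip c))).
  apply: eq_bigr => c _; rewrite big_bool /flip -[in G c](id_bit c).
  by case: (c i) => //=; rewrite addrC.
by rewrite big_split mulr2n [X in _ = _ + X](reindex_inj (inv_inj flipK)).
Qed.

(** Resetting bit [i] of both labels in all ways counts each pair four times; dividing by 4 reduces
    to the four amplitudes of one pair of qubits without splitting it off the index type. *)
Lemma eq_sum_set_bit i V W :
  (forall c d, \sum_(x : bool) \sum_(y : bool) V (set_bit c i x) (set_bit d i y) =
               \sum_(x : bool) \sum_(y : bool) W (set_bit c i x) (set_bit d i y)) ->
  \sum_c \sum_d V c d = \sum_c \sum_d W c d.
Proof.
have quad V' : \sum_c \sum_d \sum_(x : bool) \sum_(y : bool)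
      V' (set_bit c i x) (set_bit d i y)
    = (\sum_c \sum_d V' c d) *+ 4.
  rewrite (mulrnA _ 2 2) -(sum_set_bit i (fun c => \sum_d V' c d)) -sumrMnl.
  apply: eq_bigr => c _; rewrite exchange_big /= -sumrMnl.
  by apply: eq_bigr => x _; rewrite (sum_set_bit i (fun d => V' (set_bit c i x) d)).
move=> h; have : (\sum_c \sum_d V c d) *+ 4 = (\sum_c \sum_d W c d) *+ 4.
  by rewrite -!quad; apply: eq_bigr => c _; apply: eq_bigr => d _.
by move/eqP; rewrite eqr_pMn2r // => /eqP.
Qed.

Lemma set_bitE c i x : set_bit c i x i = x.
Proof. by rewrite ffunE eqxx. Qed.

Lemma set_set_bit c i x y : set_bit (set_bit c i x) i y = set_bit c i y.
Proof. by apply/ffunP => j; rewrite !ffunE; case: eqP. Qed.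

Lemma set_bitC c i j x y : i != j ->
  set_bit (set_bit c i x) j y = set_bit (set_bit c j y) i x.
Proof.
move=> neq; apply/ffunP => k; rewrite !ffunE; case: eqP => // ->.
by rewrite eq_sym (negbTE neq).
Qed.

(** The gate diagonalises the swap of the pair: -1 on the singlet, read as outcome 10, and 1 on the
    triplet. The multiplier [A] stands for the signs of the other pairs and so is independent of the
    bits at [i]. *)
Lemma bell_at_swap i V W (A : bits 'I_n -> bits 'I_n -> R[i]) :
  (forall c d x y, A (set_bit c i x) (set_bit d i y) = A c d) ->
  \sum_c \sum_d (bell_at i V c d)^* *
      (A c d * (if c i && ~~ d i then -1 else 1)) * bell_at i W c d
  = \sum_c \sum_d (V c d)^* * A c d * W (set_bit c i (d i)) (set_bit d i (c i)).
Proof.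
move=> AE; apply: (@eq_sum_set_bit i) => c d.
rewrite !big_bool /bell_at !set_bitE !set_set_bit !AE /=.
rewrite !(rmorphM, rmorphD, rmorphB, rmorphN) /= half_root_conj.
have := half_root_sqr; set t := s => tt; clearbody t.
move: (V _ _)^* (V _ _)^* (V _ _)^* (V _ _)^* (W _ _) (W _ _) (W _ _) (W _ _) (A _ _).
move=> v1 v2 v3 v4 w1 w2 w3 w4 a.
have tE x k y : t * x * k * (t * y) = 2^-1 * (x * k * y) by rewrite -tt; ring.
by rewrite !tE; field.
Qed.

Lemma bell_at_isometry i V W (A : bits 'I_n -> bits 'I_n -> R[i]) :
  (forall c d x y, A (set_bit c i x) (set_bit d i y) = A c d) ->
  \sum_c \sum_d (bell_at i V c d)^* * A c d * bell_at i W c d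
  = \sum_c \sum_d (V c d)^* * A c d * W c d.
Proof.
move=> AE; apply: (@eq_sum_set_bit i) => c d.
rewrite !big_bool /bell_at !set_bitE !set_set_bit !AE /=.
rewrite !(rmorphM, rmorphD, rmorphB, rmorphN) /= half_root_conj.
have := half_root_sqr; set t := s => tt; clearbody t.
move: (V _ _)^* (V _ _)^* (V _ _)^* (V _ _)^* (W _ _) (W _ _) (W _ _) (W _ _) (A _ _).
move=> v1 v2 v3 v4 w1 w2 w3 w4 a.
have tE x k y : t * x * k * (t * y) = 2^-1 * (x * k * y) by rewrite -tt; ring.
by rewrite !tE; field.
Qed.

(** Gates on other pairs commute with the swap of pair [i]. *)
Lemma bell_run_swap (l : seq 'I_n) i W c d : i \notin l ->
  bell_run l (fun c d => W (set_bit c i (d i)) (set_bit d i (c i))) c d =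
  bell_run l W (set_bit c i (d i)) (set_bit d i (c i)).
Proof.
elim/last_ind: l c d => // l j IH c d.
rewrite mem_rcons inE negb_or => /andP[neq il].
have bitE e k x : k != j -> set_bit e j x k = e k by move=> /negbTE h; rewrite ffunE h.
have bitE' e x : set_bit e i x j = e j by rewrite ffunE eq_sym (negbTE neq).
rewrite !bell_run_rcons /bell_at !IH // !bitE' !bitE //.
by rewrite !(set_bitC _ _ _ neq).
Qed.

Definition swap_sign (Y : {set 'I_n}) c d : R[i] :=
  \prod_(i in Y) (if c i && ~~ d i then -1 else 1).

(** Peel off the last gate. If its qubit is in [X], [bell_at_swap] trades gate and sign for a swap,
    which moves past the earlier gates into [W]; otherwise unitarity cancels the gate. [V] and [W]
    are separate because the swaps accumulate on one side only. *)
Lemma bell_run_sign (X : {set 'I_n}) (l : seq 'I_n) V W : uniq l ->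
  let Y := [set i in X | i \in l] in
  \sum_c \sum_d (bell_run l V c d)^* * swap_sign Y c d * bell_run l W c d =
  \sum_c \sum_d (V c d)^* * W (mix Y c d) (mix Y d c).
Proof.
elim/last_ind: l V W => [|l i IH] V W /=.
  move=> _; apply: eq_bigr => c _; apply: eq_bigr => d _.
  have -> : [set i in X | i \in [::]] = set0.
    by apply/setP => i; rewrite !inE andbF.
  have mix0 b b' : mix set0 b b' = b by apply/ffunP => i; rewrite ffunE inE.
  by rewrite /swap_sign big_set0 mulr1 !mix0.
rewrite rcons_uniq => /andP[il uniq_l]; rewrite !bell_run_rcons.
set Y := [set j in X | j \in l].
have iY : i \notin Y by rewrite inE (negbTE il) andbF.
have signE c d x y : swap_sign Y (set_bit c i x) (set_bit d i y) = swap_sign Y c d.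
  apply: eq_bigr => j jY; rewrite !ffunE; case: eqP => // eji.
  by rewrite eji (negbTE iY) in jY.
have [iX|iX] := boolP (i \in X); last first.
  have -> : [set j in X | j \in rcons l i] = Y.
    apply/setP => j; rewrite !inE mem_rcons inE; case: eqP => // ->.
    by rewrite (negbTE iX).
  by rewrite (bell_at_isometry _ _ signE) IH.
have -> : [set j in X | j \in rcons l i] = i |: Y.
  by apply/setP => j; rewrite !inE mem_rcons inE; case: eqP => // ->; rewrite iX.
transitivity (\sum_c \sum_d (bell_at i (bell_run l V) c d)^* *
    (swap_sign Y c d * (if c i && ~~ d i then -1 else 1)) * bell_at i (bell_run l W) c d).
  apply: eq_bigr => c _; apply: eq_bigr => d _; congr (_ * _ * _).
  by rewrite /swap_sign big_setU1 //= mulrC.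
rewrite (bell_at_swap _ _ signE).
transitivity (\sum_c \sum_d (bell_run l V c d)^* * swap_sign Y c d *
    bell_run l (fun c d => W (set_bit c i (d i)) (set_bit d i (c i))) c d).
  by apply: eq_bigr => c _; apply: eq_bigr => d _; rewrite bell_run_swap.
rewrite IH //; apply: eq_bigr => c _; apply: eq_bigr => d _; congr (_ * W _ _).
  apply/ffunP => j; rewrite !ffunE !inE (negbTE il) andbF.
  by case: eqP => [->|].
apply/ffunP => j; rewrite !ffunE !inE (negbTE il) andbF.
by case: eqP => [->|].
Qed.

Definition bell_circuit : circuit bell_gates (n + n) := [:: bell_layer (enum 'I_n)].

Lemma bell_circuit_wf : circuit_wf bell_circuit.
Proof.
rewrite /circuit_wf /= andbT /layer_wf.
elim: (enum 'I_n) (enum_uniq 'I_n) => //= i l IH /andP[il /IH ul].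
have notin (f : 'I_n -> 'I_(n + n)) :
    (forall j, (f i == lshift n j) || (f i == rshift n j) -> i = j) ->
    f i \notin flatten [seq gate_qubits a | a <- bell_layer l].
  move=> fP; elim: l il {IH ul} => //= j l IH; rewrite !inE !negb_or => /andP[neq il].
  by rewrite IH // andbT -negb_or; apply: contra neq => /fP ->.
rewrite ul andbT !inE negb_or notin ?notin ?eq_lrshift //= => j.
  by rewrite eq_rlshift eq_rshift /= => /eqP.
by rewrite eq_lrshift eq_lshift orbF => /eqP.
Qed.

Definition sample_bits (o : bits 'I_(n + n)) : seq bool :=
  [seq o q | q <- enum 'I_(n + n)].

Definition singlet (o : bits 'I_(n + n)) i : bool := o (lshift n i) && ~~ o (rshift n i).

Lemma eq_bell_run l V W c d : (forall c d, V c d = W c d) ->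
  bell_run l V c d = bell_run l W c d.
Proof.
move=> eqVW; elim/last_ind: l c d => [|l i IH] c d; first exact: eqVW.
by rewrite !bell_run_rcons /bell_at !IH.
Qed.

Lemma swap_sign_parity (Y : {set 'I_n}) c d :
  swap_sign Y c d =
  (-1) ^+ (\xor_(i < n) ((i \in Y) && singlet (cat_bits c d) i)).
Proof.
rewrite /swap_sign big_mkcond /=.
rewrite (@big_morph _ _ (fun b : bool => (-1) ^+ b : R[i]) 1 *%R false addb) //;
  last exact: signr_addb.
apply: eq_bigr => i _; rewrite /singlet cat_bitsl cat_bitsr.
by case: (i \in Y); case: (c i); case: (d i).
Qed.

Lemma swap_test (psi : vec R 'I_n) (X : {set 'I_n}) :
  rc (\sum_o (-1) ^+ (\xor_(i < n) ((i \in X) && singlet o i)) *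
    outcome_prob bell_circuit (two_copies psi) o) = purity psi X.
Proof.
rewrite rmorph_sum sum_cat_bits /=.
have -> : X = [set i in X | i \in enum 'I_n].
  by apply/setP => i; rewrite inE mem_enum andbT.
set Y := [set i in X | _].
transitivity (\sum_c \sum_d (psi c * psi d)^* * (psi (mix Y c d) * psi (mix Y d c))).
  pose V c d := psi c * psi d.
  rewrite -(bell_run_sign X V V (enum_uniq 'I_n)).
  apply: eq_bigr => c _; apply: eq_bigr => d _.
  have tcE : run_circuit bell_circuit (two_copies psi) (cat_bits c d) =
      bell_run (enum 'I_n) (fun c d => psi c * psi d) c d.
    rewrite /run_circuit /= cats0 run_bell_layer.
    apply: eq_bell_run => c' d'; rewrite ffunE.
    by congr (psi _ * psi _); apply/ffunP => i; rewrite ffunE ?cat_bitsl ?cat_bitsr.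
  rewrite rmorphM /= /outcome_prob tcE sqmodE mulrA.
  rewrite [in RHS](mulrC _ (swap_sign _ _ _)); congr (_ * _ * _).
  by rewrite rmorphXn rmorphN rmorph1 -/Y swap_sign_parity.
rewrite /purity; apply: eq_bigr => c _; apply: eq_bigr => d _.
by rewrite rmorphM.
Qed.
End SwapTest.

(** * Success probability *)

Lemma sum_tuple_prod (S : comPzSemiRingType) (I : finType) (T : nat) (F : I -> S) :
  \sum_(o : T.-tuple I) \prod_(t < T) F (tnth o t) = (\sum_i F i) ^+ T.
Proof.
rewrite -[in RHS](card_ord T) -prodr_const bigA_distr_bigA /=.
rewrite (reindex (fun f : {ffun 'I_T -> I} => [tuple f t | t < T])) /=.
  by apply: eq_bigr => f _; apply: eq_bigr => t _; rewrite tnth_mktuple.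
exists (fun o : T.-tuple I => [ffun t => tnth o t]) => [f|o] _.
  by apply/ffunP => t; rewrite ffunE tnth_mktuple.
by apply: eq_from_tnth => t; rewrite tnth_mktuple ffunE.
Qed.

Section Success.
Variables (R : realType) (n : nat) (eps : R) (P : {set {set 'I_n}}).
Variable psi : vec R 'I_n.
Hypotheses (eps_gt0 : 0 < eps) (inst : many_cut_instance eps P psi).
Local Notation rc := (real_complex R).

Let p := outcome_prob (bell_circuit R n) (two_copies psi).

Definition parity (X : {set 'I_n}) (o : bits 'I_(n + n)) : bool :=
  \xor_(i < n) ((i \in X) && singlet o i).

Let p_ge0 o : 0 <= p o. Proof. exact: sqmod_ge0. Qed.

(** The swap test for the empty set, where every sign is 1. *)
Lemma sum_prob : \sum_o p o = 1.
Proof.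
apply: (@complexI R).
have sat0 : saturated P set0 by apply/saturatedP => i j _; rewrite !inE.
rewrite -[RHS](purity_saturated inst sat0) -swap_test; congr (rc _).
apply: eq_bigr => o _; rewrite big1 ?expr0 ?mul1r // => i _.
by rewrite inE.
Qed.

Lemma sum_sign X : \sum_o (-1) ^+ parity X o * p o =
   \sum_(o | ~~ parity X o) p o - \sum_(o | parity X o) p o.
Proof.
rewrite (bigID (parity X)) /= addrC -sumrN; congr (_ + _).
  by apply: eq_bigr => o /negbTE ->; rewrite expr0 mul1r.
by apply: eq_bigr => o ->; rewrite expr1 mulN1r.
Qed.

(** The expected sign is 1 minus twice the probability of odd parity; being 1, it forces that
    probability to vanish. *)
Lemma saturated_parity X o : saturated P X -> p o != 0 -> parity X o = false.
Proof.
move=> satX po; apply: contraNF po => odd_o.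
have sumE : \sum_(o | ~~ parity X o) p o - \sum_(o | parity X o) p o = 1.
  rewrite -sum_sign; apply: (@complexI R).
  by rewrite -[LHS]/(rc _) swap_test (purity_saturated inst satX).
have := sum_prob; rewrite (bigID (parity X)) /= => tot.
have /eqP : \sum_(o | parity X o) p o = 0 by lra.
rewrite psumr_eq0 // => /allP/(_ o).
by rewrite mem_index_enum odd_o => /(_ isT).
Qed.

(** Even parity has probability (1 + expected sign) / 2, and sqrt (1 - eps^2) <= 1 - eps^2 / 2. As
    eps < 1, the latter bound is nonnegative and squares can be compared. *)
Lemma cut_even X : ~~ saturated P X ->
  \sum_(o | ~~ parity X o) p o <= 1 - eps ^+ 2 / 4.
Proof.
move=> cutX; set E := \sum_(o | parity X o) p o; set F := \sum_(o | _) _.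
have tot : E + F = 1 by rewrite -sum_prob (bigID (parity X)).
have := purity_cut inst eps_gt0 cutX.
rewrite -swap_test sqmod_real -/p sum_sign -/E -/F => le_sqr.
have eps_lt1 := cut_lt1 inst eps_gt0 cutX.
have : (F - E) ^+ 2 <= (1 - eps ^+ 2 / 2) ^+ 2.
  apply: le_trans le_sqr _; rewrite -subr_ge0.
  have -> : (1 - eps ^+ 2 / 2) ^+ 2 - (1 - eps ^+ 2) = (eps ^+ 2 / 2) ^+ 2 by field.
  exact: sqr_ge0.
have sqr_lt1 : eps ^+ 2 < 1 by rewrite expr_lt1 // ltW.
have pos : 0 <= 1 - eps ^+ 2 / 2 by lra.
move=> le_sqr'; have : F - E <= 1 - eps ^+ 2 / 2.
  rewrite leNgt; apply/negP => lt; move: le_sqr'; apply/negP.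
  by rewrite -ltNge; nra.
lra.
Qed.

Lemma nth_sample_bits (o : bits 'I_(n + n)) (k : 'I_(n + n)) :
  nth false (sample_bits o) k = o k.
Proof.
by rewrite (nth_map k) ?size_enum_ord // nth_ord_enum.
Qed.

Lemma singlet_sample_bits (o : bits 'I_(n + n)) (i : 'I_n) :
  singlet_bit n (sample_bits o) i = singlet o i.
Proof.
by rewrite /singlet -!nth_sample_bits.
Qed.

Definition decode T (o : T.-tuple (bits 'I_(n + n))) : seq nat :=
  labels n [seq @sample_bits n x | x <- o].

Lemma identifies_decode T (o : T.-tuple (bits 'I_(n + n))) :
  (forall X, saturated P X <-> forall t, parity X (tnth o t) = false) ->
  identifies (decode o) P.
Proof.
move=> h; case: (inst) => partP _ _; apply: identifies_labels => // X.
split=> [/h even a /mapP[x /tnthP[t ->] ->]|even].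
  rewrite -[RHS](even t); apply: eq_bigr => i _.
  by rewrite singlet_sample_bits.
apply/h => t; rewrite -[RHS](even (sample_bits (tnth o t))).
  by apply: eq_bigr => i _; rewrite singlet_sample_bits.
by apply: map_f; apply: mem_tnth.
Qed.

(** Outcomes of positive probability are even on every union of blocks, so a wrong answer requires a
    cut set that is even on all samples; the union bound runs over cut sets only. *)
Lemma success_ge T :
  1 - \sum_(X | ~~ saturated P X) (\sum_(o | ~~ parity X o) p o) ^+ T <=
  success_prob (bell_circuit R n) (@decode T) psi P.
Proof.
rewrite lerBlDr -(expr1n _ T) -sum_prob -sum_tuple_prod /success_prob.
rewrite [X in _ <= X + _]big_mkcond /=.
have -> : \sum_(X | ~~ saturated P X) (\sum_(o | ~~ parity X o) p o) ^+ T =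
   \sum_(o : T.-tuple (bits 'I_(n + n))) \sum_(X | ~~ saturated P X)
     \prod_(t < T) (if ~~ parity X (tnth o t) then p (tnth o t) else 0).
  rewrite exchange_big /=; apply: eq_bigr => X _.
  by rewrite big_mkcond -sum_tuple_prod.
rewrite -big_split /=; apply: ler_sum => o _.
have term_ge0 X : 0 <= \prod_(t < T) (if ~~ parity X (tnth o t) then p (tnth o t) else 0).
  by apply: prodr_ge0 => t _; case: ifP.
have [_|bad] := ifP; first by rewrite lerDl sumr_ge0.
rewrite add0r; have [->|] := eqVneq (\prod_(t < T) p (tnth o t)) 0.
  by rewrite sumr_ge0.
move/prodf_neq0 => p_neq0.
have [X /andP[cutX /forallP evenX]] :
    exists X, ~~ saturated P X && [forall t, ~~ parity X (tnth o t)].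
  apply/existsP; apply: contraFT bad => /existsPn noX.
  apply: identifies_decode => X; split=> [satX t|even].
    by apply: saturated_parity => //; apply: p_neq0.
  apply: contraT => cutX; have := noX X; rewrite cutX /= => /negP; case.
  by apply/forallP => t; rewrite even.
rewrite (bigD1 X) //=; apply: ler_wpDr; first by apply: sumr_ge0.
by apply: ler_prod => t _; rewrite p_ge0 evenX lexx.
Qed.

End Success.

(** With x = 1 / (N - 1), 1 - 1 / N is the inverse of 1 + x, and Bernoulli's inequality gives (1 +
    x)^N >= 1 + N x >= 2. *)
Lemma bernoulli_half (R : realFieldType) (N : nat) : (1 < N)%N ->
  (1 - N%:R^-1) ^+ N <= 2^-1 :> R.
Proof.
case: N => [|[|N]] // _; set y : R := N.+1%:R; pose x := y^-1.
have y_gt0 : 0 < y by rewrite ltr0n.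
have yE : N.+2%:R = y + 1 by rewrite natr1.
have x_gt0 : 0 < x by rewrite invr_gt0.
have xE : 1 - N.+2%:R^-1 = (1 + x)^-1 :> R.
  have N_ge0 : 0 <= N%:R :> R by exact: ler0n.
  by rewrite /x yE; field; rewrite !gt_eqF //; lra.
have bern m : 1 + m%:R * x <= (1 + x) ^+ m.
  elim: m => [|m IH]; first by rewrite mul0r addr0.
  rewrite exprS; apply: le_trans (ler_wpM2l _ IH); last by lra.
  rewrite -natr1; have : 0 <= m%:R * x * x by rewrite !mulr_ge0 ?ler0n // ltW.
  nra.
rewrite xE exprVn lef_pV2 ?posrE ?exprn_gt0 //; [|lra].
apply: le_trans (bern _); rewrite yE mulrDl mul1r mulfV ?gt_eqF //; lra.
Qed.

Lemma success_bound (R : realType) n (eps : R) (P : {set {set 'I_n}}) psi (k : nat) :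
  (0 < n)%N -> 0 < eps -> eps^-1 <= k%:R -> many_cut_instance eps P psi ->
  2%:R / 3%:R <= success_prob (bell_circuit R n) (@decode n (num_rounds n k)) psi P.
Proof.
move=> n_gt0 eps_gt0 le_k inst; apply: le_trans (success_ge inst _).
set p := outcome_prob _ _; set T := num_rounds n k.
have [/existsP[X0 cutX0]|/existsPn nocut] :=
    boolP [exists X, ~~ saturated P X]; last first.
  rewrite big1 => [|X /negP []]; last by have := nocut X; rewrite negbK.
  lra.
have eps_lt1 := cut_lt1 inst eps_gt0 cutX0.
have k_ge2 : (2 <= k)%N.
  rewrite -(ltr_nat R); apply: lt_le_trans le_k.
  by rewrite invf_gt1.
have k_gt0 : 0 < k%:R :> R by rewrite ltr0n; lia.
(* As 1 / k <= eps, this choice gives 1 - eps^2 / 4 <= 1 - 1 / N. *)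
pose N := (4 * k ^ 2)%N.
pose q : R := 1 - N%:R^-1.
have NE : N%:R = 4 * k%:R ^+ 2 :> R by rewrite natrM natrX.
have N_gt0 : 0 < N%:R :> R by rewrite NE mulr_gt0 ?exprn_gt0.
have N_gt1 : (1 < N)%N by rewrite /N; nia.
have q_ge0 : 0 <= q by rewrite subr_ge0 invf_le1 // ler1n ltnW.
have q_le1 : q <= 1 by rewrite gerBl invr_ge0 ltW.
have le_q X : ~~ saturated P X -> \sum_(o | ~~ parity X o) p o <= q.
  move=> cutX; apply: le_trans (cut_even eps_gt0 inst cutX) _.
  rewrite lerB // NE invfM mulrC ler_wpM2r ?invr_ge0 ?ler0n // -exprVn.
  have k_inv : k%:R^-1 <= eps by rewrite -[eps]invrK lef_pV2 ?posrE ?invr_gt0.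
  by rewrite lerXn2r ?nnegrE ?invr_ge0 ?ler0n // ltW.
have term X : ~~ saturated P X -> (\sum_(o | ~~ parity X o) p o) ^+ T <= 8^-1 ^+ n.
  move=> /le_q le; apply: (@le_trans _ _ (q ^+ T)).
    by apply: lerXn2r => //; rewrite ?nnegrE //; apply: sumr_ge0 => o _; apply: sqmod_ge0.
  (* Every N rounds halve the probability, so 3 n N rounds yield 8^-n; summed over at most 2^n sets
     this is 4^-n <= 1 / 4. *)
  apply: (@le_trans _ _ (q ^+ (N * (3 * n)))).
    apply: ler_wiXn2l => //.
    (* As k >= 2, 24 k (k - 1) is at least 12 k^2 = 3 N. *)
    rewrite /T /num_rounds /N; case: (k) k_ge2 => // k' k'_gt0 /=; nia.
  have -> : (8^-1 : R) = 2^-1 ^+ 3 by field.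
  have half : q ^+ N <= 2^-1 := bernoulli_half R N_gt1.
  rewrite (exprM q N) (exprM _ 3) lerXn2r ?nnegrE ?exprn_ge0 ?invr_ge0 //.
  by rewrite lerXn2r ?nnegrE ?exprn_ge0 ?invr_ge0.
have total : \sum_(X | ~~ saturated P X) (\sum_(o | ~~ parity X o) p o) ^+ T <= 4^-1.
  apply: le_trans (ler_sum _ term) _.
  rewrite sumr_const; apply: (@le_trans _ _ (8^-1 ^+ n *+ 2 ^ n)).
    apply: ler_wpMn2l; first by rewrite exprn_ge0 ?invr_ge0.
    have -> : (2 ^ n = #|{: {set 'I_n}}|)%N.
      by rewrite -cardsT -powersetT card_powerset cardsT card_ord.
    exact: max_card.
  rewrite -mulr_natr natrX -exprMn; have -> : (8^-1 * 2 : R) = 4^-1 by field.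
  by rewrite -[leRHS]expr1; apply: ler_wiXn2l => //; lra.
by lra.
Qed.

(** * Encodings, running time and assembly *)

Lemma enc_seq_map (A B : Type) (f : B -> tree) (g : A -> B) (s : seq A) :
  enc_seq f (map g s) = enc_seq (f \o g) s.
Proof. by elim: s => //= a s ->. Qed.

Lemma enc_bitsE N (o : bits 'I_N) :
  enc_bits o = enc_seq enc_bool [seq o q | q <- enum 'I_N].
Proof. by rewrite /enc_bits !enc_seq_map. Qed.

Lemma enc_bell_circuit (R : realType) n :
  enc_circuit (bell_circuit R n) =
  TCons (enc_seq enc_pair_gate [seq (i, (n + i)%N) | i <- iota 0 n]) TNil.
Proof.
rewrite /enc_circuit /= /bell_layer enc_seq_map -val_enum_ord -map_comp enc_seq_map.
by congr (TCons _ _).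
Qed.

Definition cut_algorithm (R : realType) : algorithm R :=
  Algorithm (bell_gates R) generator_com postproc_com.

(** The summands pay for the generator, for [T] rounds of n gates and 2n qubits, and for the
    post-processing with T + 1 <= 25 (n + k)^3. *)
Definition cut_time (n k : nat) : nat := ((500 + 72 + 3000 * 25) * (n + k) ^ 5)%N.

Lemma executes_cut (R : realType) n (eps : R) : (0 < n)%N ->
  let k := `|Num.ceil eps^-1|%N in (0 < k)%N ->
  @executes R (cut_algorithm R) n eps (num_rounds n k) (bell_circuit R n)
    (@decode n (num_rounds n k)) (cut_time n k).
Proof.
move=> n_gt0 k k_gt0; set T := num_rounds n k.
exists (500 * n.+1 * k.+1 ^ 2)%N, (3000 * n.+1 ^ 2 * T.+1)%N; split.
- apply: runs_computes; first exact: runs_generator.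
  by congr (TCons _ _); rewrite -(enc_bell_circuit R).
- exact: bell_circuit_wf.
- move=> o; apply: (@runs_computes _ [:: enc_seq enc_nat (decode o)]); last by [].
  have -> : enc_seq (@enc_bits (n + n)) o =
      enc_seq (enc_seq enc_bool) [seq sample_bits x | x <- o].
    rewrite enc_seq_map; elim: (tval o) => //= x s ->.
    by rewrite enc_bitsE.
  have := @runs_postproc n (enc_nat k) [seq sample_bits x | x <- o].
  by rewrite size_map size_tuple.
- rewrite /num_gates /= cats0 size_map size_enum_ord.
  have T_le : (T <= 24 * (n + k) ^ 3)%N.
    rewrite /T /num_rounds; case: (k) k_gt0 => // k' _ /=.
    set m := (n + k'.+1)%N.
    rewrite (_ : m ^ 3 = m * (m * m))%N; last by rewrite !expnS expn0 muln1.
    have h1 : (k' <= m)%N by rewrite /m; lia.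
    have h2 : (k'.+1 <= m)%N by rewrite /m; lia.
    have h3 : (n <= m)%N by rewrite /m; lia.
    have := leq_mul h1 (leq_mul h2 h3); lia.
  set m := (n + k)%N in T_le *.
  have hn : (n.+1 <= m)%N by rewrite /m; lia.
  have hk : (k.+1 <= m)%N by rewrite /m; lia.
  have m2 : (2 <= m)%N by rewrite /m; lia.
  have pos j : (0 < m ^ j)%N by rewrite expn_gt0; lia.
  have t1 : (500 * n.+1 * k.+1 ^ 2 <= 500 * m ^ 5)%N.
    rewrite -mulnA leq_mul2l /=.
    apply: (@leq_trans (m * m ^ 2)); first by rewrite leq_mul // leq_exp2r.
    by rewrite -expnS leq_pexp2l //; lia.
  have t2 : (T * (n + (n + n)) <= 72 * m ^ 5)%N.
    apply: (@leq_trans ((24 * m ^ 3) * (3 * m ^ 2))); last by rewrite mulnACA -expnD.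
    apply: leq_mul => //; have : (m ^ 1 <= m ^ 2)%N by rewrite leq_pexp2l //; lia.
    rewrite expn1; lia.
  have t3 : (3000 * n.+1 ^ 2 * T.+1 <= 3000 * 25 * m ^ 5)%N.
    apply: (@leq_trans ((3000 * m ^ 2) * (25 * m ^ 3))); last by rewrite mulnACA -expnD.
    apply: leq_mul; first by rewrite leq_mul2l leq_exp2r.
    have := pos 3; lia.
  apply: leq_trans (leq_add (leq_add t1 t2) t3) _.
  by rewrite /cut_time -/m -!mulnDl leqnn.
Qed.

Theorem theorem8 (R : realType) :
  exists (alg : algorithm R) (depth : nat) (C : R) (A : R) (d : nat),
    forall (n : nat) (eps : R), (0 < n)%N -> 0 < eps ->
      exists (T : nat) (circ : circuit (gates alg) (n + n))
             (answer : T.-tuple (bits 'I_(n + n)) -> seq nat) (time : nat),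
        [/\ executes eps circ answer time,
            (size circ <= depth)%N,
            (2 * T)%:R <= C * (n%:R / eps ^+ 2),
            time%:R <= A * (n%:R + eps^-1) ^+ d &
            forall (P : {set {set 'I_n}}) (psi : vec R 'I_n),
              many_cut_instance eps P psi ->
              2%:R / 3%:R <= success_prob circ answer psi P].
Proof.
(* Two copies per round make 48 k (k - 1) n copies, and k (k - 1) <= 2 / eps^2, whence 96. The
   factor 2^5 comes from n + k <= 2 (n + 1 / eps), as n >= 1 and k < 1 / eps + 1. *)
exists (cut_algorithm R), 1%N, 96, ((500 + 72 + 3000 * 25)%:R * 2 ^+ 5), 5%N.
move=> n eps n_gt0 eps_gt0.
set k := `|Num.ceil eps^-1|%N.
have y_gt0 : 0 < eps^-1 by rewrite invr_gt0.
have kE : k%:R = (Num.ceil eps^-1)%:~R :> R.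
  by rewrite natr_absz ger0_norm // ltW // ceil_gt0.
have k_gt0 : (0 < k)%N by rewrite absz_gt0 gt_eqF // ceil_gt0.
have le_k : eps^-1 <= k%:R by rewrite kE ceil_ge.
have k_lt : k%:R - 1 < eps^-1.
  by rewrite kE; have := ceilB1_lt eps^-1; rewrite intrB.
exists (num_rounds n k), (bell_circuit R n), (@decode n _), (cut_time n k); split.
- exact: executes_cut.
- by [].
- rewrite -exprVn; set y := eps^-1 in y_gt0 le_k k_lt *.
  (* For k >= 2 one has k <= 2 (k - 1), and k - 1 < 1 / eps by the ceiling; for k = 1 the left side
     is 0. *)
  have kk : (k.-1 * k)%:R <= 2 * y ^+ 2.
    have [->|k_ge2] : k = 1%N \/ (2 <= k)%N by lia.
      by rewrite mul0n mulr_ge0 // sqr_ge0.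
    have : (k.-1 * k)%:R <= (2 * k.-1 ^ 2)%:R :> R.
      by rewrite ler_nat; case: (k) k_ge2 => // k' /=; nia.
    move/le_trans; apply; rewrite natrM natrX ler_wpM2l // lerXn2r ?nnegrE ?ler0n ?ltW //.
    by rewrite -subn1 natrB.
  have -> : (2 * num_rounds n k)%:R = 48 * (k.-1 * k)%:R * n%:R :> R.
    by rewrite -!natrM /num_rounds; congr (_%:R); lia.
  have n_ge0 : 0 <= n%:R :> R by exact: ler0n.
  rewrite (_ : 96 * (n%:R * y ^+ 2) = 48 * (2 * y ^+ 2) * n%:R); last by ring.
  by rewrite ler_wpM2r // ler_wpM2l.
- have n_ge1 : 1 <= n%:R :> R by rewrite ler1n.
  have nk_le : (n + k)%:R <= 2 * (n%:R + eps^-1) by rewrite natrD; lra.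
  rewrite /cut_time natrM natrX -mulrA -exprMn ler_wpM2l ?ler0n //.
  by apply: lerXn2r => //; rewrite nnegrE ?ler0n //; apply: le_trans nk_le.
- by move=> P psi; apply: success_bound.
Qed.
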